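(* Let $T\in\mathbb{Z}_+$, let $N_T\in\mathbb{R}^{(T+1)q\times(T+1)m}$ be the input-output matrix of a discrete-time linear system $(A,B,C,D)$ (see context), and let $1\ge\gamma\ge0$, $\varepsilon>0$, $1/2>\delta>0$. Suppose that the prior distribution $\mathbb{P}_{U_T}$ of the input sequence $U_T$ is the Gaussian distribution $\mathcal{N}_{(T+1)m}(0,\Sigma)$. The Gaussian mechanism $Y_{w,T}=N_TU_T+W_T$ induced by $W_T\sim\mathcal{N}_{(T+1)q}(\mu_w,\Sigma_w)$ is $(\mathbb{P}_{U_T},\gamma,\varepsilon,\delta)$-Bayesian differentially private at the finite time $T$ if the covariance matrix $\Sigma_w\succ0$ is chosen such that $$\lambda_{\max}^{-1/2}\left(\mathcal{O}_{\Sigma,\Sigma_w,T}\right)\ge c(\gamma,T)\,\mathsf{R}(\varepsilon,\delta),$$ where $$\mathcal{O}_{\Sigma,\Sigma_w,T}:=\Sigma^{1/2}N_T^\top\Sigma_w^{-1}N_T\Sigma^{1/2}$$ and $c(\gamma,T)$ is the unique $c>0$ that satisfies $$\gamma=\int_0^{c^2/2}\frac{1}{2^{(T+1)m/2}\,\Gamma((T+1)m/2)}\,x^{(T+1)m/2-1}e^{-x/2}\,dx .$$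
   Context: **System.** Consider $x(t+1)=Ax(t)+Bu(t)$, $y(t)=Cx(t)+Du(t)$, $t\in\mathbb{Z}_+=\{0,1,2,\dots\}$, $x(0)=0$, with $A\in\mathbb{R}^{n\times n}$, $B\in\mathbb{R}^{n\times m}$, $C\in\mathbb{R}^{q\times n}$, $D\in\mathbb{R}^{q\times m}$. Stack $U_T=[u(0);\dots;u(T)]\in\mathbb{R}^{(T+1)m}$ and $Y_T=[y(0);\dots;y(T)]\in\mathbb{R}^{(T+1)q}$. Then $Y_T=N_TU_T$, where $N_T$ is the block lower triangular Toeplitz matrix with $(i,j)$ block ($0\le i,j\le T$) equal to $D$ if $i=j$, $CA^{i-j-1}B$ if $i>j$, and $0$ if $i<j$. Adding a random noise vector $W_T\in\mathbb{R}^{(T+1)q}$ to the output gives the mechanism $Y_{w,T}=N_TU_T+W_T$. **Bayesian differential privacy.** Let $U_T,U'_T$ be independent random vectors, both with distribution $\mathbb{P}_{U_T}$, and independent of $W_T$. Given $1\ge\gamma\ge0$, $\varepsilon>0$ and $\delta\ge0$, the mechanism is $(\mathbb{P}_{U_T},\gamma,\varepsilon,\delta)$-Bayesian differentially private at time $T$ if, for every Borel set $\mathcal{S}\subset\mathbb{R}^{(T+1)q}$, $$\mathbb{P}\Bigl[\,\mathbb{P}[N_TU_T+W_T\in\mathcal{S}\mid U_T]\le e^{\varepsilon}\,\mathbb{P}[N_TU'_T+W_T\in\mathcal{S}\mid U'_T]+\delta\,\Bigr]\ge\gamma .$$ Here the outer probability is taken with respect to $(U_T,U'_T)$ and the inner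 ones with respect to $W_T$. **Notation.** $\mathcal{N}_k(\mu,\Sigma)$ is the nondegenerate Gaussian distribution on $\mathbb{R}^k$ with mean $\mu\in\mathbb{R}^k$ and covariance $\Sigma\succ0$. $\succ0$ means (symmetric) positive definite, $\Sigma^{1/2}$ is the principal square root, $\lambda_{\max}$ is the largest eigenvalue, and $\lambda_{\max}^{-1/2}(M):=(\lambda_{\max}(M))^{-1/2}$, read as $+\infty$ if $\lambda_{\max}(M)=0$. $\Gamma$ is the gamma function. $\mathsf{Q}(c):=\frac{1}{\sqrt{2\pi}}\int_c^\infty e^{-v^2/2}\,dv$, $\mathsf{Q}^{-1}$ is its inverse function, and $\mathsf{R}(\varepsilon,\delta):=\dfrac{\mathsf{Q}^{-1}(\delta)+\sqrt{(\mathsf{Q}^{-1}(\delta))^2+2\varepsilon}}{2\varepsilon}$. *)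

(* Defs.v *)
(* MathComp / MathComp-Analysis *)
From mathcomp Require Import all_boot all_order all_algebra.
From mathcomp Require Import all_classical all_reals all_analysis.
Set Implicit Arguments.
Unset Strict Implicit.
Unset Printing Implicit Defensive.
Import Order.TTheory GRing.Theory Num.Theory.
Import numFieldNormedType.Exports.
Local Open Scope classical_set_scope.
Local Open Scope ring_scope.

(* R^((T+1)k), as the type of stacked vectors [v(0); ...; v(T)]
   (= \mxcol_(t < T.+1) v t); the index sum equals T.+1 * k only
   propositionally. *)
Notation stackdim T k := (\sum_(t < T.+1) k)%N.

Definition io_block (R : realType) (n m q : nat) (A : 'M[R]_n)
    (B : 'M[R]_(n, m)) (C : 'M[R]_(q, n)) (D : 'M[R]_(q, m)) (i j : nat) :
    'M[R]_(q, m) :=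
  if i == j then D
  else if (j < i)%N then C *m (A ^+ (i - j - 1)) *m B else 0.

Definition io_matrix (R : realType) (n m q : nat) (A : 'M[R]_n)
    (B : 'M[R]_(n, m)) (C : 'M[R]_(q, n)) (D : 'M[R]_(q, m)) (T : nat) :
    'M[R]_(stackdim T q, stackdim T m) :=
  \mxblock_(i < T.+1, j < T.+1) io_block A B C D i j.

Section matrices.
Context {R : realType} {k : nat}.
Implicit Type M : 'M[R]_k.

Definition posdefmx M : Prop :=
  M^T = M /\ forall x : 'cV[R]_k, x != 0 -> 0 < (x^T *m M *m x) 0 0.

Definition possemidefmx M : Prop :=
  M^T = M /\ forall x : 'cV[R]_k, 0 <= (x^T *m M *m x) 0 0.

(* Principal square root; meaningful for positive semidefinite M, where the
   described matrix exists and is unique. *)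
Definition sqrtmx M : 'M[R]_k :=
  get [set S : 'M[R]_k | possemidefmx S /\ S *m S = M].

(* The set of eigenvalues is finite, so for k > 0 and M symmetric this
   supremum is a maximum. *)
Definition lambda_max M : R := sup [set a : R | eigenvalue M a].

Definition inv_sqrt_lambda_max M : \bar R :=
  if lambda_max M == 0 then +oo%E else ((Num.sqrt (lambda_max M))^-1)%:E.

End matrices.

(* R^k with its Borel sigma-algebra. *)
Definition borelcV (R : realType) (k : nat) : measurableType _ :=
  g_sigma_algebraType (@open 'cV[R]_k).

(* Integral of a nonnegative Borel function over R^k against k-dimensional
   Lebesgue measure, written (Tonelli) as an iterated integral over the
   coordinates. *)
Fixpoint lebesgue_int (R : realType) (k : nat) :
    ('cV[R]_k -> \bar R) -> \bar R :=
  match k with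
  | 0%N => fun f => f 0
  | k'.+1 => fun f =>
      (\int[@lebesgue_measure R]_x
         lebesgue_int (fun y : 'cV[R]_k' => f (col_mx (x%:M : 'cV[R]_1) y)))%E
  end.

Definition gaussian_pdf (R : realType) (k : nat) (mu : 'cV[R]_k)
    (Sigma : 'M[R]_k) (x : 'cV[R]_k) : R :=
  (Num.sqrt ((2 * pi) ^+ k * \det Sigma))^-1 *
  expR (- ((x - mu)^T *m invmx Sigma *m (x - mu)) 0 0 / 2).

Definition is_gaussian (R : realType) (k : nat) (mu : 'cV[R]_k)
    (Sigma : 'M[R]_k) (Q : probability (borelcV R k) R) : Prop :=
  posdefmx Sigma /\
  forall S : set (borelcV R k), measurable S ->
    Q S = lebesgue_int (fun x => (gaussian_pdf mu Sigma x * \1_S x)%:E).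

Definition independent3 (R : realType) d (Omega : measurableType d)
    (P : probability Omega R) d1 d2 d3 (E1 : measurableType d1)
    (E2 : measurableType d2) (E3 : measurableType d3)
    (X : {RV P >-> E1}) (Y : {RV P >-> E2}) (Z : {RV P >-> E3}) : Prop :=
  forall A B C, measurable A -> measurable B -> measurable C ->
    P (X @^-1` A `&` Y @^-1` B `&` Z @^-1` C) =
    (P (X @^-1` A) * P (Y @^-1` B) * P (Z @^-1` C))%E.

(* (PU, gamma, eps, delta)-Bayesian differential privacy of Y = N U + W with
   W ~ PW. As W is independent of (U, U'), the conditional probability given
   U is the probability over W alone, with the value U omega frozen. The
   condition depends only on PU and PW, hence the quantification over all
   realizations (U, U', W). *)
Definition bayesian_dp (R : realType) (k l : nat) (N : 'M[R]_(l, k))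
    (PW : probability (borelcV R l) R) (PU : probability (borelcV R k) R)
    (gamma eps delta : R) : Prop :=
  forall (d : measure_display) (Omega : measurableType d)
    (P : probability Omega R)
    (U U' : {RV P >-> borelcV R k}) (W : {RV P >-> borelcV R l}),
  (forall S, measurable S -> distribution P U S = PU S) ->
  (forall S, measurable S -> distribution P U' S = PU S) ->
  (forall S, measurable S -> distribution P W S = PW S) ->
  independent3 U U' W ->
  forall S : set (borelcV R l), measurable S ->
  let pr (u : 'cV[R]_k) : \bar R :=
    P [set omega | S (N *m u + (W omega : 'cV[R]_l))] in
  (gamma%:E <=
   P [set omega | pr (U omega) <= (expR eps)%:E * pr (U' omega) + delta%:E])%E.

Definition Gamma (R : realType) (a : R) : R :=
  \int[@lebesgue_measure R]_(t in `[0, +oo[) (t `^ (a - 1) * expR (- t)).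

(* Distribution function of the chi-square law with k degrees of freedom. *)
Definition chi2_cdf (R : realType) (k : nat) (b : R) : R :=
  \int[@lebesgue_measure R]_(x in `[0, b])
    ((2 `^ (k%:R / 2) * Gamma (k%:R / 2))^-1 *
     x `^ (k%:R / 2 - 1) * expR (- x / 2)).

Definition Qfun (R : realType) (c : R) : R :=
  (Num.sqrt (2 * pi))^-1 *
  \int[@lebesgue_measure R]_(v in `[c, +oo[) expR (- v ^+ 2 / 2).

(* Qfun is a decreasing bijection from R onto ]0, 1[; arbitrary outside. *)
Definition Qinv (R : realType) (p : R) : R := get [set c : R | Qfun c = p].

Definition Rfun (R : realType) (eps delta : R) : R :=
  (Qinv delta + Num.sqrt (Qinv delta ^+ 2 + 2 * eps)) / (2 * eps).

(* Main.v *)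
Require Import Defs.
From HB Require Import structures.
From mathcomp Require Import all_boot all_order all_algebra.
From mathcomp Require Import all_classical all_reals all_analysis.
From mathcomp Require Import measurable_realfun.
From mathcomp Require Import ring lra.
Set Implicit Arguments.
Unset Strict Implicit.
Unset Printing Implicit Defensive.
Import Order.TTheory GRing.Theory Num.Theory.
Import numFieldNormedType.Exports.
Local Open Scope classical_set_scope.
Local Open Scope ring_scope.

(* Write Sigma = S S and U = S z, U' = S z' with z, z' independent standard
   Gaussian vectors of R^k, where k = (T+1)m.  Then (z - z') / sqrt 2 is
   standard Gaussian and |z - z'| <= c has probability
   chi2_cdf k (c^2 / 2) = gamma.  On this event d := N_T (U - U') satisfies
     d^T Sigma_w^-1 d = (z - z')^T O (z - z') <= lambda_max O * c^2
                     <= 1 / R(eps, delta)^2,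
   and then the privacy loss of the Gaussian mechanism between N_T U and
   N_T U', a normal variable of mean |d|^2 / 2 and variance |d|^2 for the norm
   of Sigma_w^-1, exceeds eps with probability at most
   Q((eps - |d|^2 / 2) / |d|) <= delta.

   No determinant is ever evaluated: a linear change of variables is used up to
   an unknown constant factor, which the normalization of the given probability
   measures then determines. *)

(** * Quadratic forms *)

Section bilinear_forms.
Context {R : realType}.

(** Two obstacles shape the proof. The integral over [R^k] is given by recursion on the dimension,
    so its invariance under translations and dilations is visible, but its behaviour under a general
    linear map is not. It is therefore represented by a sigma-finite measure, for which Tonelli's
    theorem compares two functions under the same linear map; taking one of them Gaussian yields
    both the passage from covariance [Sigma] to the identity and the invariance under reflections.
    The other obstacle is the chi-square law, which calls for polar coordinates. They are replaced
    by the image of Lebesgue measure under the squared norm: volumes of balls scale like [s^(k/2)],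
    which already fixes the density up to a factor. As for the constants, [1 / Rfun eps delta] is
    the positive root [r] of [r^2 / 2 + Qinv delta * r = eps], the largest distance at which the
    tail bound still holds, and the halving in [c^2 / 2] reflects that [z - z'] has twice the
    identity as covariance. *)

Definition bform k (M : 'M[R]_k) (x y : 'cV[R]_k) : R := (x^T *m M *m y) 0 0.

Definition sqnorm k (x : 'cV[R]_k) : R := (x^T *m x) 0 0.

Lemma sqnormE k (x : 'cV[R]_k) : sqnorm x = \sum_i x i 0 ^+ 2.
Proof. by rewrite /sqnorm mxE; apply: eq_bigr => i _; rewrite mxE expr2. Qed.

Lemma sqnorm_ge0 k (x : 'cV[R]_k) : 0 <= sqnorm x.
Proof. by rewrite sqnormE sumr_ge0// => i _; rewrite sqr_ge0. Qed.

Lemma sqnorm_eq0 k (x : 'cV[R]_k) : (sqnorm x == 0) = (x == 0).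
Proof.
apply/eqP/eqP => [|->]; last by rewrite /sqnorm mulmx0 mxE.
rewrite sqnormE => /psumr_eq0P x0; apply/colP => i; rewrite mxE.
by apply/eqP; rewrite -sqrf_eq0 x0// => j _; rewrite sqr_ge0.
Qed.

Lemma sqnorm0 k : sqnorm (0 : 'cV[R]_k) = 0.
Proof. by apply/eqP; rewrite sqnorm_eq0. Qed.

Lemma sqnorm_gt0 k (x : 'cV[R]_k) : (0 < sqnorm x) = (x != 0).
Proof. by rewrite lt_def sqnorm_ge0 andbT sqnorm_eq0. Qed.

Lemma trmx_opp m n (M : 'M[R]_(m, n)) : (- M)^T = - M^T.
Proof. by apply/matrixP => i j; rewrite !mxE. Qed.

Lemma sqnormN k (x : 'cV[R]_k) : sqnorm (- x) = sqnorm x.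
Proof. by rewrite /sqnorm trmx_opp mulNmx mulmxN opprK. Qed.

Lemma sqnormZ k a (x : 'cV[R]_k) : sqnorm (a *: x) = a ^+ 2 * sqnorm x.
Proof. by rewrite !sqnormE mulr_sumr; apply: eq_bigr => i _;
  rewrite mxE exprMn. Qed.

Lemma sqnorm_col_mx k (x : R) (y : 'cV[R]_k) :
  sqnorm (col_mx (x%:M : 'cV_1) y) = x ^+ 2 + sqnorm y.
Proof.
rewrite /sqnorm tr_col_mx mul_row_col mxE; congr (_ + _).
by rewrite tr_scalar_mx -scalar_mxM mxE eqxx mulr1n expr2.
Qed.

Lemma bform1 k (x : 'cV[R]_k) : bform 1%:M x x = sqnorm x.
Proof. by rewrite /bform mulmx1. Qed.

Lemma bform1_col_mx k (r x : R) (u y : 'cV[R]_k) :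
  bform 1%:M (col_mx (r%:M : 'cV_1) u) (col_mx (x%:M : 'cV_1) y) =
  r * x + bform 1%:M u y.
Proof.
rewrite /bform !mulmx1 tr_col_mx mul_row_col mxE; congr (_ + _).
by rewrite tr_scalar_mx -scalar_mxM mxE eqxx mulr1n.
Qed.

Lemma bformDl k (M : 'M[R]_k) x y z :
  bform M (x + y) z = bform M x z + bform M y z.
Proof. by rewrite /bform linearD/= !mulmxDl mxE. Qed.

Lemma bformDr k (M : 'M[R]_k) x y z :
  bform M z (x + y) = bform M z x + bform M z y.
Proof. by rewrite /bform !mulmxDr mxE. Qed.

Lemma bformZl k (M : 'M[R]_k) a x y : bform M (a *: x) y = a * bform M x y.
Proof. by rewrite /bform linearZ/= -!scalemxAl mxE. Qed.

Lemma bformZr k (M : 'M[R]_k) a x y : bform M x (a *: y) = a * bform M x y.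
Proof. by rewrite /bform -!scalemxAr mxE. Qed.

Lemma bformNN k (M : 'M[R]_k) x : bform M (- x) (- x) = bform M x x.
Proof. by rewrite /bform trmx_opp !mulNmx mulmxN opprK. Qed.

Lemma bformC k (M : 'M[R]_k) x y : M^T = M -> bform M x y = bform M y x.
Proof.
move=> Ms; rewrite /bform; suff -> : x^T *m M *m y = (y^T *m M *m x)^T.
  by rewrite mxE.
by rewrite !trmx_mul trmxK Ms mulmxA.
Qed.

Lemma bform_sum k (M : 'M[R]_k) x y :
  bform M x y = \sum_i \sum_j x i 0 * M i j * y j 0.
Proof.
rewrite /bform mxE exchange_big/=; apply: eq_bigr => j _.
by rewrite mxE big_distrl/=; apply: eq_bigr => i _; rewrite mxE.
Qed.

Lemma bform_mul k (M S : 'M[R]_k) x :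
  bform M (S *m x) (S *m x) = bform (S^T *m M *m S) x x.
Proof. by rewrite /bform trmx_mul !mulmxA. Qed.

Lemma bform_le_sqnorm k (M : 'M[R]_k) :
  exists2 K, 0 < K & forall x, bform M x x <= K * sqnorm x.
Proof.
(* The summand [1] keeps the bound strictly positive even for [M = 0]; [rayleigh_max] divides by
   it. *)
exists (1 + \sum_i \sum_j `|M i j|).
  by rewrite ltr_pwDl// sumr_ge0// => i _; rewrite sumr_ge0.
move=> x; rewrite bform_sum mulrDl mul1r -[leLHS]add0r lerD ?sqnorm_ge0//.
rewrite big_distrl ler_sum//= => i _; rewrite big_distrl ler_sum//= => j _.
have coordle (l : 'I_k) : x l 0 ^+ 2 <= sqnorm x.
  by rewrite sqnormE (bigD1 l)//= lerDl sumr_ge0// => ? _; rewrite sqr_ge0.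
have xij : `|x i 0| * `|x j 0| <= sqnorm x.
  have := coordle i; have := coordle j;
    rewrite -(real_normK (num_real (x i 0))).
  rewrite -(real_normK (num_real (x j 0)));
    have := sqr_ge0 (`|x i 0| - `|x j 0|); nra.
apply: (le_trans (ler_norm _)); rewrite !normrM mulrAC mulrC.
exact: ler_wpM2l.
Qed.

Lemma posdefmx_psd k (M : 'M[R]_k) : posdefmx M -> possemidefmx M.
Proof.
move=> [Ms M0]; split=> // x; have [->|/M0/ltW//] := eqVneq x 0.
by rewrite trmx0 !mul0mx mxE.
Qed.

Lemma psd_cauchy_schwarz k (M : 'M[R]_k) x y : possemidefmx M ->
  bform M x y ^+ 2 <= bform M x x * bform M y y.
Proof.
move=> [Ms M0].
have quad t s : 0 <= t ^+ 2 * bform M x x + 2 * t * s * bform M x y +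
    s ^+ 2 * bform M y y.
  have := M0 (t *: x + s *: y); rewrite -/(bform _ _ _).
  rewrite !(bformDl, bformDr, bformZl, bformZr) (bformC y x)//; lra.
have x0 : 0 <= bform M x x := M0 x.
have y0 : 0 <= bform M y y := M0 y.
move: (bform M x x) (bform M x y) (bform M y y) => a b c in quad x0 y0 *.
(* With [a], [b], [c] the three values of the form, these choices give [a * (a * c - b^2) >= 0] and
   [c * (a * c - b^2) >= 0]. When neither [a] nor [c] is positive, [quad] at [(1, 1)] and [(1, -1)]
   forces [b = 0]. *)
have h1 := quad (- b) a; have h2 := quad c (- b).
have [a0|a0] := ltP 0 a; first nra.
have [c0|c0] := ltP 0 c; first nra.
have h3 := quad 1 1; have h4 := quad 1 (-1); nra.
Qed.

Lemma posdefmx_unit k (M : 'M[R]_k) : posdefmx M -> M \in unitmx.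
Proof.
move=> [Ms M0]; rewrite -row_free_unit -kermx_eq0; apply/eqP/row_matrixP => i.
rewrite row0; set v := row i _.
have vM : v *m M = 0 by apply/sub_kermxP; exact: row_sub.
apply: trmx_inj; rewrite trmx0; apply/eqP/negP => /negP/M0.
by rewrite trmxK vM mul0mx mxE ltxx.
Qed.

Lemma trmx_invmx_sym k (M : 'M[R]_k) : M^T = M -> (invmx M)^T = invmx M.
Proof. by move=> Ms; rewrite trmx_inv Ms. Qed.

Lemma bform_invmx k (M : 'M[R]_k) x : M^T = M -> M \in unitmx ->
  bform (invmx M) x x = bform M (invmx M *m x) (invmx M *m x).
Proof.
by move=> Ms Mu; rewrite bform_mul trmx_invmx_sym// mulVmx// mul1mx.
Qed.

(* The supremum [lam] of the Rayleigh quotient is an eigenvalue: otherwise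
   [L := lam - M] is invertible and the Cauchy-Schwarz inequality for [L],
   applied to [x] and [L^-1 x], bounds [bform L x x] below by a positive
   multiple of [sqnorm x]. *)
Lemma rayleigh_max k (M : 'M[R]_k) : (0 < k)%N -> M^T = M ->
  exists2 lam, eigenvalue M lam & forall x, bform M x x <= lam * sqnorm x.
Proof.
move=> k0 Ms.
pose E := [set r | exists2 x : 'cV[R]_k, x != 0 & r = bform M x x / sqnorm x].
have [K K0 MK] := bform_le_sqnorm M.
have Eub : has_ubound E.
  exists K => _ [x x0 ->]; rewrite ler_pdivrMr ?sqnorm_gt0//.
have E0 : E !=set0.
  exists (bform M (const_mx 1) (const_mx 1) / sqnorm (const_mx 1 : 'cV_k)).
  exists (const_mx 1) => //; apply/eqP => /colP/(_ (Ordinal k0)).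
  by rewrite !mxE; apply/eqP/oner_neq0.
have sE x : bform M x x <= sup E * sqnorm x.
  have [->|x0] := eqVneq x 0.
    by rewrite /bform /sqnorm !mulmx0 mxE mulr0.
  by rewrite -ler_pdivrMr ?sqnorm_gt0// ub_le_sup//; exists x.
exists (sup E) => //; pose L := (sup E)%:M - M.
have LE x : bform L x x = sup E * sqnorm x - bform M x x.
  rewrite /bform /L mulmxBr mulmxBl mxE; congr (_ + _).
    by rewrite mul_mx_scalar -scalemxAl mxE.
  by rewrite mxE.
have Lsym : L^T = L by rewrite /L linearB/= tr_scalar_mx Ms.
have Lpsd : possemidefmx L.
  by split=> // x; rewrite -/(bform L x x) LE subr_ge0.
rewrite /eigenvalue /eigenspace kermx_eq0 row_free_unit; apply/negP.
rewrite -opprB -scaleN1r unitmxZ ?unitrN1// -/L => Lu.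
have [J J0 LJ] := bform_le_sqnorm (invmx L).
suff : sup E <= sup E - J^-1.
  by apply/negP; rewrite -ltNge gtrBl invr_gt0.
apply: ge_sup => // _ [x x0 ->]; rewrite ler_pdivrMr ?sqnorm_gt0//.
rewrite mulrBl lerBrDl -lerBrDr -LE mulrC ler_pdivrMr//.
have := psd_cauchy_schwarz x (invmx L *m x) Lpsd.
rewrite -bform_invmx//.
have -> : bform L x (invmx L *m x) = sqnorm x.
  by rewrite /bform -mulmxA mulKVmx.
have x1 : 0 < sqnorm x by rewrite sqnorm_gt0.
have Lx0 : 0 <= bform L x x := Lpsd.2 x.
move=> h; have {}h : sqnorm x ^+ 2 <= bform L x x * (J * sqnorm x).
  by apply: (le_trans h); rewrite ler_wpM2l.
by rewrite -(ler_pM2r x1) -expr2 -mulrA.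
Qed.

(** A supremum is informative only for a bounded set. The Rayleigh maximum [lam] is an eigenvalue
    and, by evaluating the form at eigenvectors, an upper bound of all of them. Eigenvectors are row
    vectors, hence the transpositions. *)
Lemma bform_le_lambda_max k (M : 'M[R]_k) x : (0 < k)%N -> M^T = M ->
  bform M x x <= lambda_max M * sqnorm x.
Proof.
move=> k0 Ms; have [lam lamM Mlam] := rayleigh_max k0 Ms.
apply: (le_trans (Mlam x)); rewrite ler_wpM2r ?sqnorm_ge0//.
apply: ub_le_sup => //; exists lam => a /= /eigenvalueP[v vM v0].
have := Mlam v^T; rewrite /bform trmxK vM -scalemxAl mxE.
rewrite -[X in a * X]/((v *m v^T) 0 0) -{1}(trmxK v) -/(sqnorm v^T).
by rewrite ler_pM2r// sqnorm_gt0 trmx_eq0.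
Qed.

(** Reflection in the hyperplane orthogonal to [u - v]. Being symmetric and involutive it is
    orthogonal; it splits off an eigenvector in [spectral] and turns a vector onto the first axis in
    [bform_gaussian_tail]. *)
Lemma householder k (u v : 'cV[R]_k) : sqnorm u = sqnorm v ->
  exists H : 'M[R]_k, [/\ H^T = H, H *m H = 1%:M & H *m u = v].
Proof.
move=> uv; have [->|] := eqVneq u v.
  by exists 1%:M; rewrite trmx1 !mul1mx.
rewrite -subr_eq0; set w := u - v => w0.
have w0' : sqnorm w != 0 by rewrite sqnorm_eq0.
have wwT : (w^T *m w) = (sqnorm w)%:M by rewrite [LHS]mx11_scalar.
exists (1%:M - (2 / sqnorm w) *: (w *m w^T)); split.
- by rewrite linearB/= trmx1 linearZ/= trmx_mul trmxK.
- set Q := w *m w^T; have QQ : Q *m Q = sqnorm w *: Q.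
    by rewrite /Q mulmxA -(mulmxA w) wwT mul_mx_scalar -scalemxAl.
  set e := 2 / sqnorm w.
  have -> : (1%:M - e *: Q) *m (1%:M - e *: Q) =
      1%:M + (e * e * sqnorm w - e - e) *: Q.
    rewrite mulmxDr mulmx1 mulmxDl mul1mx mulNmx mulmxN opprK.
    rewrite -scalemxAl -scalemxAr QQ !scalerA !scalerDl !scaleNr -!addrA.
    by congr (_ + _); rewrite [RHS]addrC -addrA.
  by rewrite (_ : _ - e = 0) ?scale0r ?addr0// /e; field.
- rewrite mulmxBl mul1mx -scalemxAl -mulmxA [w^T *m u]mx11_scalar.
  rewrite mul_mx_scalar scalerA.
  suff -> : 2 / sqnorm w * (w^T *m u) 0 0 = 1.
    by rewrite scale1r /w opprB addrCA subrr addr0.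
  (* This is where the equality of the lengths of [u] and [v] enters: it makes the reflection
     subtract exactly [w] from [u]. *)
  have wE : sqnorm w = 2 * (w^T *m u) 0 0.
    have -> : sqnorm w = (w^T *m u) 0 0 - (w^T *m v) 0 0.
      by rewrite /sqnorm {2}/w mulmxBr !mxE.
    rewrite mulr2n mulrDl !mul1r; congr (_ + _).
    have vu : (v^T *m u) 0 0 = (u^T *m v) 0 0.
      by have := @bformC _ 1%:M v u (trmx1 _ _); rewrite /bform !mulmx1.
    rewrite /w linearB/= !mulmxBl; move: uv; rewrite /sqnorm !mxE => ->.
    by move: vu; rewrite !mxE => ->; rewrite opprB.
  by rewrite mulrAC -wE divff.
Qed.

(** Deflation by induction on the size: a reflection carries the first basis vector to a unit
    eigenvector, and the induction hypothesis diagonalizes the remaining block. *)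
Lemma spectral k (M : 'M[R]_k) : M^T = M ->
  exists (P : 'M[R]_k) (d : 'rV[R]_k),
    P *m P^T = 1%:M /\ M = P *m diag_mx d *m P^T.
Proof.
elim: k M => [|k IH] M Ms.
  by exists 1%:M, 0; split; apply/matrixP => -[].
rewrite -[k.+1]/(1 + k)%N in M Ms *.
have [lam /eigenvalueP[v vM v0] _] := rayleigh_max (ltn0Sn k) Ms.
pose u := (Num.sqrt (sqnorm v^T))^-1 *: v^T.
have v1 : 0 < sqnorm v^T by rewrite sqnorm_gt0 trmx_eq0.
have u1 : sqnorm u = 1.
  by rewrite sqnormZ exprVn sqr_sqrtr ?sqnorm_ge0// mulVf ?gt_eqF.
have Mu : M *m u = lam *: u.
  rewrite /u -scalemxAr scalerA mulrC -scalerA; congr (_ *: _).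
  by rewrite -[M]trmxK -trmx_mul Ms vM linearZ.
pose e : 'cV[R]_(1 + k) := col_mx 1%:M 0.
have e1 : sqnorm e = 1.
  by rewrite /e sqnorm_col_mx expr1n /sqnorm mulmx0 mxE addr0.
have [H [Hs HH He]] := householder (etrans e1 (esym u1)).
have Hu : H *m u = e by rewrite -He mulmxA HH mul1mx.
pose N := H *m M *m H.
have Ns : N^T = N by rewrite /N !trmx_mul Hs Ms mulmxA.
have Ne : N *m e = lam *: e.
  by rewrite /N -mulmxA He -mulmxA Mu -scalemxAr Hu.
(* The first column of [N] is [lam *: e]; symmetry then clears the first row as well. *)
have NE : N = block_mx lam%:M 0 0 (drsubmx N).
  have : N *m e = col_mx (ulsubmx N) (dlsubmx N).
    rewrite -{1}[N]submxK /e mul_block_col !mulmx1 !mulmx0 !addr0//.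
  rewrite Ne /e scale_col_mx scaler0 scalemx1 => /eq_col_mx[Nul Ndl].
  rewrite -{1}[N]submxK -Nul -Ndl; congr (block_mx _ _ _ _).
  by rewrite -[ursubmx N]trmxK trmx_ursub Ns -Ndl trmx0.
have [|P [d [PP NP]]] := IH (drsubmx N); first by rewrite trmx_drsub Ns.
exists (H *m block_mx 1%:M 0 0 P), (row_mx lam%:M d); split.
  rewrite trmx_mul tr_block_mx !trmx0 trmx1 Hs mulmxA -(mulmxA H) mulmx_block.
  by rewrite !(mulmx0, mul0mx, mulmx1, add0r, addr0) PP -scalar_mx_block mulmx1.
rewrite trmx_mul tr_block_mx !trmx0 trmx1 Hs.
rewrite -[LHS]mul1mx -[X in X *m _]HH -[LHS]mulmx1 -[X in _ *m X]HH.
rewrite -!mulmxA; congr (H *m _); rewrite !mulmxA; congr (_ *m H).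
rewrite -/N NE diag_mx_row !mulmx_block.
rewrite !(mulmx0, mul0mx, mulmx1, mul1mx, add0r, addr0) -NP.
by congr (block_mx _ _ _ _); apply/matrixP => i j; rewrite !ord1 !mxE.
Qed.

Lemma diag_mx_psd k (d : 'rV[R]_k) : (forall i, 0 <= d 0 i) ->
  possemidefmx (diag_mx d).
Proof.
move=> d0; split=> [|x]; first exact: tr_diag_mx.
rewrite -/(bform _ x x) bform_sum sumr_ge0// => i _.
rewrite sumr_ge0// => j _; rewrite mxE.
case: eqVneq => [<-|_]; last by rewrite mulr0n mulr0 mul0r.
by rewrite mulr1n mulrAC -expr2 mulr_ge0 ?sqr_ge0.
Qed.

Lemma psd_congr k (M P : 'M[R]_k) : possemidefmx M ->
  possemidefmx (P *m M *m P^T).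
Proof.
move=> [Ms M0]; split=> [|x]; first by rewrite !trmx_mul trmxK Ms mulmxA.
rewrite -/(bform _ x x) -{1}[P]trmxK -bform_mul; exact: M0.
Qed.

Lemma sqrtmxP k (M : 'M[R]_k) : possemidefmx M ->
  possemidefmx (sqrtmx M) /\ sqrtmx M *m sqrtmx M = M.
Proof.
move=> [Ms M0]; rewrite /sqrtmx.
suff : [set S : 'M[R]_k | possemidefmx S /\ S *m S = M] !=set0 by case/getPex.
have [P [d [PP MP]]] := spectral Ms.
have PP' : P^T *m P = 1%:M by exact: mulmx1C.
(* Evaluating the form of [M] at the [i]-th column of [P] reads off the eigenvalue [d 0 i]. *)
have d0 i : 0 <= d 0 i.
  have := M0 (P *m delta_mx i 0); rewrite -/(bform _ _ _) bform_mul MP.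
  rewrite !mulmxA PP' mul1mx -mulmxA PP' mulmx1 bform_sum (bigD1 i)//=.
  rewrite [X in _ + X]big1 ?addr0; last first.
    move=> j ji; rewrite big1// => l _.
    by rewrite [X in X * _ * _]mxE (negbTE ji) !mul0r.
  rewrite (bigD1 i)//= [X in _ + X]big1 ?addr0; last first.
    by move=> j ji; rewrite [X in _ * X]mxE (negbTE ji) mulr0.
  by rewrite !mxE !eqxx !mulr1n mul1r mulr1.
pose r := \row_i Num.sqrt (d 0 i).
exists (P *m diag_mx r *m P^T); split.
  by apply/psd_congr/diag_mx_psd => i; rewrite mxE sqrtr_ge0.
rewrite !mulmxA -(mulmxA _ P^T) PP' mulmx1 -(mulmxA P) mulmx_diag MP.
congr (_ *m diag_mx _ *m _); apply/rowP => i.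
by rewrite !mxE -expr2 sqr_sqrtr.
Qed.

(** The last identity is the whitening rule: under [x = S z] the form of [invmx M] becomes the
    squared Euclidean norm of [z]. *)
Lemma sqrtmx_posdef k (M : 'M[R]_k) (S := sqrtmx M) : posdefmx M ->
  [/\ S^T = S, S \in unitmx, S *m S = M & S *m invmx M *m S = 1%:M].
Proof.
move=> Mpd; have Mu := posdefmx_unit Mpd.
have [[Ss _] SS] := sqrtmxP (posdefmx_psd Mpd); rewrite -/S in Ss SS.
split=> //; first by move: Mu; rewrite -SS unitmx_mul => /andP[].
by apply: mulmx1C; rewrite mulmxA SS mulmxV.
Qed.

End bilinear_forms.
(** * Lebesgue measure on the space of column vectors *)

Section lebesgue_affine.
Context {R : realType}.
Local Open Scope ereal_scope.
Local Notation mu := (@lebesgue_measure R).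

Lemma ge0_integral_comp d1 d2 (X : measurableType d1) (Y : measurableType d2)
    (m : {measure set X -> \bar R}) (phi : X -> Y) (f : Y -> \bar R) :
  measurable_fun setT phi -> measurable_fun setT f -> (forall y, 0 <= f y) ->
  \int[m]_x f (phi x) = \int[pushforward m phi]_y f y.
Proof. by move=> mphi mf f0; rewrite ge0_integral_pushforward. Qed.

(** The image of Lebesgue measure under the affine map, multiplied by [s], gives every half-open
    interval its length, and this characterizes Lebesgue measure. *)
Lemma integral_lebesgue_affine (s a : R) (f : R -> \bar R) : (0 < s)%R ->
  measurable_fun setT f -> (forall x, 0 <= f x) ->
  s%:E * \int[mu]_x f (s * x + a)%R = \int[mu]_x f x.
Proof.
move=> s0 mf f0.
pose phi : measurableTypeR R -> measurableTypeR R := fun x => (s * x + a)%R.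
have mphi : measurable_fun setT phi.
  by apply: measurable_funD => //; exact: measurable_funM.
rewrite (@ge0_integral_comp _ _ _ _ _ phi)//.
rewrite -(ge0_integral_mscale _ measurableT (NngNum (ltW s0)))//.
apply: eq_measure_integral => A mA _; apply/esym.
apply: lebesgue_measure_unique mA => _ [[x y]] _ <-/=.
rewrite /mscale/= /pushforward.
have -> : phi @^-1` `]x, y] = `]((x - a) / s)%R, ((y - a) / s)%R]%classic.
  apply/seteqP; split => z /=; rewrite !in_itv/= /phi
    ltr_pdivrMr// ler_pdivlMr// ltrBlDr lerBrDr mulrC//.
rewrite !lebesgue_measure_itv/= !lte_fin ltr_pM2r ?invr_gt0// ltrD2r.
case: ifPn => _; last by rewrite mule0.
by rewrite -!EFinB -EFinM -mulrBl mulrC divfK ?gt_eqF// opprB addrA subrK.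
Qed.

Lemma integral_lebesgue_shift (a : R) (f : R -> \bar R) :
  measurable_fun setT f -> (forall x, 0 <= f x) ->
  \int[mu]_x f (x + a)%R = \int[mu]_x f x.
Proof.
move=> mf f0; rewrite -[RHS](@integral_lebesgue_affine 1 a)// mul1e.
by apply: eq_integral => x _; rewrite mul1r.
Qed.

End lebesgue_affine.

(** * Borel sets of [R^k] and measurability by coordinates *)

Section borelcV.
Context {R : realType}.

Lemma measurable_coord k (i : 'I_k) :
  measurable_fun setT (fun x : borelcV R k => (x : 'cV[R]_k) i 0).
Proof.
apply: (measurability _ (RGenOpens.measurableE R)) => _ [_ [a [b ->]] <-].
rewrite setTI; apply: sub_sigma_algebra.
apply: (@open_comp _ _ (fun x : 'cV[R]_k => x i 0)); last exact: interval_open.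
by move=> x _; exact: coord_continuous.
Qed.

(* Every open set is a countable union of boxes with rational centers. *)
Lemma measurable_fun_cV d (T : measurableType d) k (f : T -> borelcV R k) :
  (forall i, measurable_fun setT (fun t => (f t : 'cV[R]_k) i 0)) ->
  measurable_fun setT f.
Proof.
move=> mf; apply: (@measurability _ _ _ _ setT f (@open 'cV[R]_k)) =>
  // _ [U oU <-].
rewrite setTI.
pose box (qn : 'cV[rat]_k * nat) : set 'cV[R]_k :=
  [set y | forall i, `|ratr (qn.1 i 0) - y i 0| < qn.2.+1%:R^-1].
have -> : U = \bigcup_(qn in [set qn | box qn `<=` U]) box qn.
  apply/seteqP; split => [x Ux|x [qn/= qnU /qnU]//].
  have /nbhs_ballP[e /= e0 xeU] : nbhs x U by exact: open_nbhs_nbhs.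
  have [n] : exists n, n.+1%:R^-1 < e / 2.
    have e20 : 0 < e / 2 by rewrite divr_gt0.
    have [n _ nP] := near_infty_natSinv_lt (PosNum e20).
    by exists n; apply: nP => /=.
  move=> ne.
  have q_ (i : 'I_k) : exists q : rat, `|ratr q - x i 0| < n.+1%:R^-1.
    have xx : x i 0 - n.+1%:R^-1 < x i 0 + n.+1%:R^-1.
      by rewrite ltrD2l gtrN// invr_gt0.
    have [q /itvP qP] := rat_in_itvoo xx; exists q.
    by rewrite ltr_distl !qP.
  pose q := \col_i projT1 (cid (q_ i)).
  exists (q, n) => /=; last by move=> i; rewrite mxE; case: cid.
  move=> y boxy; apply: xeU; split => // i j; rewrite (ord1 j).
  have := boxy i; rewrite /= mxE; case: cid => r /= rx ry.
  rewrite /ball/= -(subrK (ratr r) (x i 0)) -addrA.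
  rewrite (le_lt_trans (ler_normD _ _))// (splitr e) ltrD//.
    by rewrite distrC (lt_trans rx).
  exact: lt_trans ry ne.
rewrite preimage_bigcup bigcup_mkcond.
apply: countable_bigcupT_measurable => [|qn].
  exact: countableP.
case: ifPn => // _.
have -> : f @^-1` box qn = \bigcap_(i in setT)
    [set t | `|ratr (qn.1 i 0) - (f t : 'cV[R]_k) i 0| < qn.2.+1%:R^-1].
  by apply/seteqP; split => [t ft i _|t ft i]; exact: ft.
apply: fin_bigcap_measurable => // i _.
rewrite -[X in measurable X]setTI.
apply: (@measurable_fun_ltr _ _ _ setT (fun t =>
  `|ratr (qn.1 i 0) - (f t : 'cV[R]_k) i 0|) (cst _)) => //.
apply: measurableT_comp => //; exact: measurable_funB.
Qed.

End borelcV.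
(** An image of a sigma-finite measure can fail to be sigma-finite, as projections show. The
    measurable left inverse [psi] pulls an exhausting sequence back to one whose pieces keep their
    finite mass. *)
Lemma pushforward_sigma_finite {R : realType} d1 d2 (X : measurableType d1)
    (Y : measurableType d2) (m : {measure set X -> \bar R})
    (phi : X -> Y) (psi : Y -> X) : sigma_finite setT m ->
  measurable_fun setT phi -> measurable_fun setT psi -> cancel phi psi ->
  exists nu : {sigma_finite_measure set Y -> \bar R},
    nu = pushforward m phi :> (set Y -> \bar R).
Proof.
move=> m_sf mphi mpsi phiK.
unshelve epose (pm := (pushforward m phi : {measure set Y -> \bar R})).
  exact: mphi.
have sf : sigma_finite setT (pushforward m phi).
  have [F FT mF] := m_sf; exists (fun n => psi @^-1` F n).
    by rewrite -preimage_bigcup -FT preimage_setT.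
  move=> n; have [mFn Fn] := mF n; split.
    by rewrite -[X in measurable X]setTI; exact: mpsi.
  rewrite /pushforward -comp_preimage.
  by rewrite (_ : psi \o phi = id)//; apply/funext => x /=; rewrite phiK.
pose mix := Measure_isSigmaFinite.Build _ _ _ pm sf.
pose nu : {sigma_finite_measure set Y -> \bar R} :=
  HB.pack (pm : set Y -> \bar R) pm mix.
by exists nu.
Qed.

Lemma col_cV0 {R : realType} k (x : R) (y : 'cV[R]_k) (i : 'I_k.+1) :
  i = 0%N :> nat -> (col_mx (x%:M : 'cV[R]_1) y : 'cV[R]_k.+1) i 0 = x.
Proof.
move=> i0; rewrite (_ : i = lshift k (0 : 'I_1)); last exact/val_inj.
by apply: etrans (@col_mxEu R 1 k 1 _ _ 0 0) _; rewrite mxE eqxx mulr1n.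
Qed.

Lemma col_cVS {R : realType} k (x : R) (y : 'cV[R]_k) (i : 'I_k.+1) (j : 'I_k) :
  i = j.+1 :> nat -> (col_mx (x%:M : 'cV[R]_1) y : 'cV[R]_k.+1) i 0 = y j 0.
Proof.
move=> ij; rewrite (_ : i = rshift 1 j); last exact/val_inj.
exact: (@col_mxEd R 1 k 1).
Qed.

(** Both exhausting sequences are taken nondecreasing, so that the rectangles [F n] times [G n]
    already cover: coordinates caught at stages [i] and [j] are both caught at their maximum. *)
Lemma product_measure_sigma_finite {R : realType} d1 d2
    (X : measurableType d1) (Y : measurableType d2)
    (m1 : {sigma_finite_measure set X -> \bar R})
    (m2 : {sigma_finite_measure set Y -> \bar R}) :
  sigma_finite setT (m1 \x m2)%E.
Proof.
have /sigma_finiteP[F [FT ndF mF]] := sigma_finiteT m1.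
have /sigma_finiteP[G [GT ndG mG]] := sigma_finiteT m2.
exists (fun n => F n `*` G n) => [|n].
  apply/esym; rewrite -subTset => -[x y] _.
  have : [set: X] x by []. rewrite FT => -[i _ Fx].
  have : [set: Y] y by []. rewrite GT => -[j _ Gy].
  exists (maxn i j) => //; split.
    by move: x Fx; exact/subsetPset/ndF/leq_maxl.
  by move: y Gy; exact/subsetPset/ndG/leq_maxr.
have [[mFn Fn] [mGn Gn]] := (mF n, mG n).
split; first exact: measurableX.
by rewrite product_measure1E// lte_mul_pinfty// ge0_fin_numE.
Qed.

Section borelcV_functions.
Context {R : realType}.
Context d (T : measurableType d).

Lemma measurable_cV_add k (f g : T -> borelcV R k) :
  measurable_fun setT f -> measurable_fun setT g ->
  measurable_fun setT (fun t => (f t : 'cV[R]_k) + g t : borelcV R k).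
Proof.
move=> mf mg; apply: measurable_fun_cV => i.
under eq_fun do rewrite mxE.
by apply: measurable_funD; exact: (measurableT_comp (measurable_coord i)).
Qed.

Lemma measurable_cV_mul k l (A : 'M[R]_(l, k)) (f : T -> borelcV R k) :
  measurable_fun setT f ->
  measurable_fun setT (fun t => A *m (f t : 'cV[R]_k) : borelcV R l).
Proof.
move=> mf; apply: measurable_fun_cV => i; under eq_fun do rewrite mxE.
apply: measurable_sum => j; apply: measurable_funM => //.
exact: (measurableT_comp (measurable_coord j)).
Qed.

Lemma measurable_cV_scale k (a : R) (f : T -> borelcV R k) :
  measurable_fun setT f ->
  measurable_fun setT (fun t => a *: (f t : 'cV[R]_k) : borelcV R k).
Proof.
move=> mf; under eq_fun do rewrite -mul_scalar_mx; exact: measurable_cV_mul.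
Qed.

Lemma measurable_cV_opp k (f : T -> borelcV R k) :
  measurable_fun setT f ->
  measurable_fun setT (fun t => - (f t : 'cV[R]_k) : borelcV R k).
Proof.
by move=> mf; under eq_fun do rewrite -scaleN1r; exact: measurable_cV_scale.
Qed.

Lemma measurable_cV_col_mx k (f : T -> R) (g : T -> borelcV R k) :
  measurable_fun setT f -> measurable_fun setT g ->
  measurable_fun setT
    (fun t => col_mx ((f t)%:M : 'cV[R]_1) (g t) : borelcV R k.+1).
Proof.
move=> mf mg; apply: measurable_fun_cV => /= i.
have [j|j] := splitP (i : 'I_(1 + k)).
  by rewrite (ord1 j) => i0; apply: eq_measurable_fun mf => t _;
    rewrite col_cV0.
move=> ij; have mj := measurableT_comp (measurable_coord j) mg.
by apply: eq_measurable_fun mj => t _; rewrite (@col_cVS _ _ _ _ _ j).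
Qed.

Lemma measurable_bform k (M : 'M[R]_k) (f g : T -> borelcV R k) :
  measurable_fun setT f -> measurable_fun setT g ->
  measurable_fun setT (fun t => bform M (f t) (g t)).
Proof.
move=> mf mg; under eq_fun do rewrite bform_sum.
apply: measurable_sum => i; apply: measurable_sum => j.
by apply: measurable_funM; [apply: measurable_funM => //|];
  exact: (measurableT_comp (measurable_coord _)).
Qed.

Lemma measurable_sqnorm k (f : T -> borelcV R k) :
  measurable_fun setT f -> measurable_fun setT (fun t => sqnorm (f t)).
Proof.
by move=> mf; under eq_fun do rewrite -bform1; exact: measurable_bform.
Qed.

End borelcV_functions.

(** * The iterated integral as integration against a measure *)

Section lebesgue_cV.
Context {R : realType}.
Local Open Scope ereal_scope.
Local Notation mu := (@lebesgue_measure R).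

Lemma lebesgue_intS k (f : 'cV[R]_k.+1 -> \bar R) :
  lebesgue_int f = \int[mu]_x
    lebesgue_int (fun y : 'cV[R]_k => f (col_mx (x%:M : 'cV[R]_1) y)).
Proof. by []. Qed.

(** Each dimension adds a coordinate by taking the image of a product measure under stacking.
    Sigma-finiteness is carried through the induction because Tonelli's theorem at the next step
    relies on it. *)
Lemma lebesgue_int_measure k :
  exists nu : {sigma_finite_measure set (borelcV R k) -> \bar R},
  forall f : borelcV R k -> \bar R,
    measurable_fun setT f -> (forall x, 0 <= f x) ->
    lebesgue_int f = \int[nu]_x f x.
Proof.
elim: k => [|k [nu nuE]].
  (* In dimension 0 the iterated integral evaluates at the only vector, which is a Dirac mass. *)
  exists (\d_(0%R : borelcV R 0)) => f mf f0.
  by rewrite integral_dirac//= diracT mul1e.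
pose phi (p : R * borelcV R k) : borelcV R k.+1 :=
  col_mx (p.1%:M : 'cV[R]_1) (p.2 : 'cV[R]_k).
pose psi (x : borelcV R k.+1) : R * borelcV R k :=
  ((x : 'cV[R]_k.+1) 0%R 0%R, @dsubmx _ 1 k 1 x).
have mphi : measurable_fun setT phi.
  by apply: measurable_cV_col_mx => //; exact: measurable_fst.
have mpsi : measurable_fun setT psi.
  apply: measurable_fun_pair; first exact: measurable_coord.
  apply: measurable_fun_cV => i; under eq_fun do rewrite mxE.
  exact: measurable_coord.
have phiK : cancel phi psi.
  move=> [x y]; rewrite /psi /phi /=; congr (_, _); last exact: col_mxKd.
  exact: col_cV0.
have [nu' nu'E] := pushforward_sigma_finite
  (product_measure_sigma_finite mu nu) mphi mpsi phiK.
exists nu' => f mf f0; rewrite nu'E -ge0_integral_comp//.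
have mfphi := measurableT_comp mf mphi.
apply: etrans (esym (@fubini_tonelli1 _ _ _ _ _ mu nu (f \o phi) mfphi _));
  last by move=> ?; exact: f0.
rewrite lebesgue_intS; apply: eq_integral => x _; rewrite nuE//.
exact: (measurableT_comp mf (measurable_cV_col_mx _ _)).
Qed.

Definition lebesgue_cV k : {sigma_finite_measure set (borelcV R k) -> \bar R} :=
  sval (cid (lebesgue_int_measure k)).

Lemma lebesgue_intE k (f : borelcV R k -> \bar R) :
  measurable_fun setT f -> (forall x, 0 <= f x) ->
  lebesgue_int f = \int[lebesgue_cV k]_x f x.
Proof. by rewrite /lebesgue_cV; case: cid => nu /=; exact. Qed.

Lemma integral_lebesgue_cV0 (f : borelcV R 0 -> \bar R) :
  measurable_fun setT f -> (forall x, 0 <= f x) ->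
  \int[lebesgue_cV 0]_x f x = f 0%R.
Proof. by move=> mf f0; rewrite -lebesgue_intE. Qed.

Lemma integral_lebesgue_cVS k (f : borelcV R k.+1 -> \bar R) :
  measurable_fun setT f -> (forall x, 0 <= f x) ->
  \int[lebesgue_cV k.+1]_x f x = \int[mu]_x \int[lebesgue_cV k]_y
    f (col_mx (x%:M : 'cV[R]_1) (y : 'cV[R]_k)).
Proof.
move=> mf f0; rewrite -lebesgue_intE// lebesgue_intS; apply: eq_integral => x _.
rewrite lebesgue_intE//.
exact: (measurableT_comp mf (measurable_cV_col_mx _ _)).
Qed.

End lebesgue_cV.

(** * Exchange of integrals and densities *)

Section nonnegative_integrals.
Context {R : realType} d1 d2 (X : measurableType d1) (Y : measurableType d2).
Local Open Scope ereal_scope.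

Lemma measurable_integral (m : {sigma_finite_measure set Y -> \bar R})
    (f : X -> Y -> \bar R) :
  measurable_fun setT (fun p : X * Y => f p.1 p.2) ->
  (forall x y, 0 <= f x y) ->
  measurable_fun setT (fun x => \int[m]_y f x y).
Proof.
move=> mf f0.
by have := @measurable_fun_fubini_tonelli_F _ _ _ _ _ m (fun p => f p.1 p.2) mf
  (fun p => f0 _ _).
Qed.

Lemma tonelli (m1 : {sigma_finite_measure set X -> \bar R})
    (m2 : {sigma_finite_measure set Y -> \bar R}) (f : X -> Y -> \bar R) :
  measurable_fun setT (fun p : X * Y => f p.1 p.2) ->
  (forall x y, 0 <= f x y) ->
  \int[m1]_x \int[m2]_y f x y = \int[m2]_y \int[m1]_x f x y.
Proof.
move=> mf f0.
by have := @fubini_tonelli _ _ _ _ _ m1 m2 (fun p => f p.1 p.2) mf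
  (fun p => f0 _ _).
Qed.

Import HBNNSimple.

(** The hypothesis describes [nu] on sets only. Simple functions follow by linearity, and monotone
    convergence on both sides gives all nonnegative measurable functions. *)
Lemma integral_density (m nu : {measure set X -> \bar R}) (p : X -> R)
    (h : X -> \bar R) :
  measurable_fun setT p -> (forall x, 0 <= p x)%R ->
  (forall E, measurable E -> nu E = \int[m]_x (p x * \1_E x)%:E) ->
  measurable_fun setT h -> (forall x, 0 <= h x) ->
  \int[nu]_x h x = \int[m]_x (h x * (p x)%:E).
Proof.
move=> mp p0 nuE mh h0; pose h_ := nnsfun_approx measurableT mh.
have hh x : (h_ n x)%:E @[n --> \oo] --> h x by exact: cvg_nnsfun_approx.
have ndh x : {homo (fun n => (h_ n x)%:E) : a b / (a <= b)%N >-> a <= b}.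
  by move=> a b ab; rewrite lee_fin; exact/lefP/nd_nnsfun_approx.
transitivity (limn (fun n => \int[nu]_x (h_ n x)%:E)).
  rewrite -monotone_convergence//.
  - by apply: eq_integral => x _; apply/esym/cvg_lim.
  - by move=> n; exact/measurable_EFinP.
  - by move=> n x _; rewrite lee_fin.
transitivity (limn (fun n => \int[m]_x ((h_ n x)%:E * (p x)%:E))); last first.
  rewrite -monotone_convergence//.
  - apply: eq_integral => x _; apply/cvg_lim => //.
    by apply: cvgeZr => //; exact: hh.
  - by move=> n; apply/measurable_EFinP; exact: measurable_funM.
  - by move=> n x _; rewrite -EFinM lee_fin mulr_ge0.
  - by move=> x _ a b ab; rewrite lee_wpmul2r ?lee_fin//; exact: ndh.
congr (limn _); apply/funext => n.
rewrite integralT_nnsfun sintegralE.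
(* This holds even for negative [r]: such an [r] is no value of [h_ n], so its indicator
   vanishes. *)
have r0 r x : (0 <= r * (p x * \1_(h_ n @^-1` [set r]) x))%R.
  rewrite indicE; case: (asboolP (h_ n x = r)) => [<-|hr].
    by rewrite !mulr_ge0.
  by rewrite memNset ?mulr0.
have mr r : measurable_fun setT
    (fun x => (p x * \1_(h_ n @^-1` [set r]) x))%R.
  by apply: measurable_funM => //; exact: measurable_indic.
transitivity (\int[m]_x \sum_(r \in range (h_ n))
    (r * (p x * \1_(h_ n @^-1` [set r]) x))%:E).
  rewrite ge0_integral_fsum//=.
  - apply: eq_fsbigr => r /set_mem[x _ <-]; under eq_integral do rewrite EFinM.
    rewrite ge0_integralZl_EFin//.
    + by rewrite nuE.
    + by move=> y _; rewrite lee_fin mulr_ge0.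
    + exact/measurable_EFinP.
  - by move=> r; apply/measurable_EFinP; exact: measurable_funM.
  - by move=> r x _; rewrite lee_fin r0.
apply: eq_integral => x _; rewrite fsumEFin// -EFinM; congr EFin.
rewrite [in RHS]fimfunE mulrC mulr_fsumr; apply: eq_fsbigr => r _.
by rewrite mulrCA.
Qed.

End nonnegative_integrals.

(** * Translations, dilations and linear maps *)

Section lebesgue_cV_invariance.
Context {R : realType}.
Local Open Scope ereal_scope.
Local Notation lambda := (@lebesgue_cV R).
Implicit Type k : nat.

Lemma integral_lebesgue_cV_shift k (a : 'cV[R]_k) (f : borelcV R k -> \bar R) :
  measurable_fun setT f -> (forall x, 0 <= f x) ->
  \int[lambda k]_x f ((x : 'cV[R]_k) + a)%R = \int[lambda k]_x f x.
Proof.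
elim: k a f => [|k IH] a f mf f0.
  rewrite !integral_lebesgue_cV0//; first by congr f; apply/matrixP => -[].
  by apply: (measurableT_comp mf); exact: measurable_cV_add.
have mfa : measurable_fun setT (fun x : borelcV R k.+1 => f (x + a)%R).
  by apply: (measurableT_comp mf); exact: measurable_cV_add.
rewrite (integral_lebesgue_cVS mfa (fun x => f0 _)).
rewrite (integral_lebesgue_cVS mf f0).
pose F x := \int[lambda k]_y f (col_mx (x%:M : 'cV[R]_1) (y : 'cV[R]_k)).
have mF : measurable_fun setT F.
  apply: measurable_integral => //; apply: (measurableT_comp mf).
  by apply: measurable_cV_col_mx; [exact: measurable_fst|exact: measurable_snd].
transitivity (\int[@lebesgue_measure R]_x F (x + a 0%R 0%R)%R).
  apply: eq_integral => x _.
  rewrite /F -[RHS](IH (@dsubmx _ 1 k 1 a))//; last first.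
    exact: (measurableT_comp mf (measurable_cV_col_mx _ _)).
  apply: eq_integral => y _; congr f.
  apply/matrixP => i j; rewrite (ord1 j) mxE.
  have [i0|] := posnP i.
    by rewrite !col_cV0// (_ : i = 0%R)//; exact/val_inj.
  move=> i0.
  have i1 : (i.-1 < k)%N by rewrite -ltnS prednK.
  have ii : i = (Ordinal i1).+1 :> nat by rewrite /= prednK.
  rewrite !(col_cVS _ _ ii) !mxE; congr (_ + a _ _)%R; exact/val_inj.
rewrite integral_lebesgue_shift// => x.
by apply: integral_ge0 => y _.
Qed.

Lemma integral_lebesgue_cV_scale k (s : R) (f : borelcV R k -> \bar R) :
  (0 < s)%R -> measurable_fun setT f -> (forall x, 0 <= f x) ->
  (s ^+ k)%:E * \int[lambda k]_x f (s *: (x : 'cV[R]_k))%R =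
    \int[lambda k]_x f x.
Proof.
move=> s0; elim: k f => [|k IH] f mf f0.
  rewrite !integral_lebesgue_cV0//; first by rewrite scaler0 expr0 mul1e.
  by apply: (measurableT_comp mf); exact: measurable_cV_scale.
have mfs : measurable_fun setT (fun x : borelcV R k.+1 =>
  f (s *: (x : 'cV[R]_k.+1))%R).
  by apply: (measurableT_comp mf); exact: measurable_cV_scale.
rewrite (integral_lebesgue_cVS mfs (fun x => f0 _)).
rewrite (integral_lebesgue_cVS mf f0).
pose F x := \int[lambda k]_y f (col_mx (x%:M : 'cV[R]_1) (y : 'cV[R]_k)).
have mF : measurable_fun setT F.
  apply: measurable_integral => //; apply: (measurableT_comp mf).
  by apply: measurable_cV_col_mx; [exact: measurable_fst|exact: measurable_snd].
have F0 x : 0 <= F x by apply: integral_ge0 => y _.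
have mG : measurable_fun setT (fun x : R => \int[lambda k]_y
    f (s *: (col_mx (x%:M : 'cV[R]_1) (y : 'cV[R]_k) : 'cV[R]_k.+1))%R).
  apply: measurable_integral => //; apply: (measurableT_comp mfs).
  by apply: measurable_cV_col_mx; [exact: measurable_fst|exact: measurable_snd].
transitivity (s%:E * \int[@lebesgue_measure R]_x F (s * x + 0)%R); last first.
  exact: integral_lebesgue_affine.
rewrite exprS EFinM -muleA; congr (_ * _).
rewrite -ge0_integralZl_EFin ?exprn_ge0 ?ltW//; last first.
  by move=> x _; apply: integral_ge0 => y _.
apply: eq_integral => x _; rewrite addr0 /F -[RHS](IH (fun y : borelcV R k =>
    f (col_mx ((s * x)%:M : 'cV[R]_1) (y : 'cV[R]_k))))//; last first.
  exact: (measurableT_comp mf (measurable_cV_col_mx _ _)).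
congr (_ * _); apply: eq_integral => y _; congr f.
rewrite -scale_scalar_mx; exact: (@scale_col_mx _ 1 k 1).
Qed.

(* Uniqueness of translation invariant measures: expand the product of the two
   integrals by Tonelli's theorem and shift the inner variable three times. *)
Lemma integral_lebesgue_cV_linear k (A : 'M[R]_k)
    (f g : borelcV R k -> \bar R) :
  A \in unitmx ->
  measurable_fun setT f -> (forall x, 0 <= f x) ->
  measurable_fun setT g -> (forall x, 0 <= g x) ->
  (forall x : 'cV[R]_k, g (- x)%R = g x) ->
  \int[lambda k]_x f (A *m (x : 'cV[R]_k))%R * \int[lambda k]_x g x =
  \int[lambda k]_x f x * \int[lambda k]_x g (A *m (x : 'cV[R]_k))%R.
Proof.
move=> Au mf f0 mg g0 gN.
have mA : measurable_fun setT (fun x : borelcV R k =>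
  A *m (x : 'cV[R]_k) : borelcV R k).
  exact: measurable_cV_mul.
have mfA := measurableT_comp mf mA; have mgA := measurableT_comp mg mA.
have m1 : measurable_fun setT (fst : borelcV R k * borelcV R k ->
  _) by exact: measurable_fst.
have m2 : measurable_fun setT (snd : borelcV R k * borelcV R k ->
  _) by exact: measurable_snd.
have mA1 := measurable_cV_mul A m1.
have mA2 := measurable_cV_mul A m2.
transitivity (\int[lambda k]_y \int[lambda k]_x
    (f (A *m (x : 'cV[R]_k) + (y : 'cV[R]_k))%R * g y)).
  rewrite -ge0_integralZl//; last by apply: integral_ge0 => x _.
  apply: eq_integral => y _; rewrite -ge0_integralZr//.
  rewrite -[RHS](integral_lebesgue_cV_shift (- (invmx A *m (y :
    'cV[R]_k)))%R)//.
  - apply: eq_integral => x _; congr (f _ * _).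
    by rewrite mulmxDr mulmxN mulKVmx// subrK.
  - apply: emeasurable_funM => //; apply: (measurableT_comp mf).
    by apply: measurable_cV_add => //.
  - by move=> x; exact: mule_ge0.
rewrite tonelli//; last by move=> x y; exact: mule_ge0.
  transitivity (\int[lambda k]_x \int[lambda k]_y
      (f y * g ((y : 'cV[R]_k) - A *m (x : 'cV[R]_k))%R)).
    apply: eq_integral => x _.
    rewrite -[RHS](integral_lebesgue_cV_shift (A *m (x : 'cV[R]_k))%R)//.
    - by apply: eq_integral => y _; rewrite addrK addrC.
    - apply: emeasurable_funM => //; apply: (measurableT_comp mg).
      exact: measurable_cV_add.
    - by move=> y; exact: mule_ge0.
  rewrite tonelli//; last by move=> x y; exact: mule_ge0.
    transitivity (\int[lambda k]_y
        (f y * \int[lambda k]_x g (A *m (x : 'cV[R]_k))%R)).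
      apply: eq_integral => y _; rewrite -ge0_integralZl//.
      rewrite -[LHS](integral_lebesgue_cV_shift (invmx A *m (y :
        'cV[R]_k))%R)//.
      (* The shift by [invmx A *m y] leaves [g] at [- A *m x], so evenness of [g] completes the
         exchange. *)
      - apply: eq_integral => x _; congr (_ * _); rewrite -gN; congr g.
        by rewrite mulmxDr mulKVmx// opprB addrK.
      - apply: emeasurable_funM => //; apply: (measurableT_comp mg).
        by apply: measurable_cV_add => //; apply: measurable_cV_opp.
      - by move=> x; exact: mule_ge0.
    by rewrite ge0_integralZr//; apply: integral_ge0 => x _.
  apply: emeasurable_funM; first exact: (measurableT_comp mf).
  apply: (measurableT_comp mg); apply: measurable_cV_add => //.
  exact: measurable_cV_opp.
apply: emeasurable_funM; last exact: (measurableT_comp mg).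
by apply: (measurableT_comp mf); apply: measurable_cV_add.
Qed.

End lebesgue_cV_invariance.
(** * Gaussian integrals *)

Section gaussian_measure.
Context {R : realType}.
Local Open Scope ereal_scope.
Local Notation lambda := (@lebesgue_cV R).
Implicit Type k : nat.

Definition sqrt2pi : R := Num.sqrt (2 * pi).

Definition gauss_cV k (x : 'cV[R]_k) : R := expR (- sqnorm x / 2).

Lemma sqrt2pi_gt0 : (0 < sqrt2pi)%R.
Proof. by rewrite sqrtr_gt0 mulr_gt0// pi_gt0. Qed.

Lemma gauss_cV_ge0 k (x : 'cV[R]_k) : (0 <= gauss_cV x)%R.
Proof. exact: expR_ge0. Qed.

Lemma measurable_expR_half d (T : measurableType d) (f : T -> R) :
  measurable_fun setT f -> measurable_fun setT (fun x => expR (- f x / 2)).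
Proof.
move=> mf; apply: measurableT_comp => //; apply: measurable_funM => //.
exact: measurableT_comp.
Qed.

Lemma measurable_gauss_cV k :
  measurable_fun setT (@gauss_cV k : borelcV R k -> R).
Proof. by apply: measurable_expR_half; exact: measurable_sqnorm. Qed.

Lemma measurable_gauss_R : measurable_fun setT (fun x : R =>
  expR (- x ^+ 2 / 2)).
Proof. by apply: measurable_expR_half; exact: measurable_funX. Qed.

Lemma gauss_cVS k (x : R) (y : 'cV[R]_k) :
  gauss_cV (col_mx (x%:M : 'cV_1) y) = (expR (- x ^+ 2 / 2) * gauss_cV y)%R.
Proof. by rewrite /gauss_cV sqnorm_col_mx opprD mulrDl expRD. Qed.

Lemma integral_gauss_R :
  \int[@lebesgue_measure R]_x (expR (- x ^+ 2 / 2))%:E = sqrt2pi%:E.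
Proof.
have s0 : (0 < Num.sqrt 2 :> R)%R by rewrite sqrtr_gt0.
(* The substitution by [sqrt 2] leads to the integral of [exp(- x^2)], which is [sqrt pi]. *)
rewrite -(@integral_lebesgue_affine _ (Num.sqrt 2) 0)//.
- rewrite /sqrt2pi sqrtrM// EFinM -integralT_gauss; congr (_ * _).
  apply: eq_integral => x _; rewrite addr0 exprMn sqr_sqrtr// /gauss_fun.
  by congr (expR _)%:E; field.
- by apply/measurable_EFinP; exact: measurable_gauss_R.
Qed.

Lemma integral_gauss_cV k :
  \int[lambda k]_x (gauss_cV x)%:E = (sqrt2pi ^+ k)%:E.
Proof.
have mg j : measurable_fun setT (fun x : borelcV R j => (gauss_cV x)%:E).
  by apply/measurable_EFinP; exact: measurable_gauss_cV.
elim: k => [|k IH].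
  rewrite integral_lebesgue_cV0// => [|x]; last by rewrite lee_fin gauss_cV_ge0.
  by rewrite /gauss_cV /sqnorm mulmx0 mxE oppr0 mul0r expR0.
rewrite integral_lebesgue_cVS// => [|x]; last by rewrite lee_fin gauss_cV_ge0.
under eq_integral => x _.
  under eq_integral do rewrite gauss_cVS EFinM.
  rewrite ge0_integralZl_EFin ?expR_ge0//; last first.
    by move=> y _; rewrite lee_fin gauss_cV_ge0.
  rewrite IH; over.
rewrite ge0_integralZr//.
- by rewrite integral_gauss_R exprS EFinM.
- by apply/measurable_EFinP; exact: measurable_gauss_R.
- by rewrite lee_fin exprn_ge0// ltW// sqrt2pi_gt0.
Qed.

(** Says that [Q] is the law of [mu + S z] with [z] standard Gaussian, the only form in which the
    noise and the prior are used later. The factor [sqrt2pi ^+ k] stays on the left to avoid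
    dividing extended reals. *)
Lemma is_gaussian_integral k (mu : 'cV[R]_k) (Sigma : 'M[R]_k)
    (Q : probability (borelcV R k) R) (h : borelcV R k -> \bar R) :
  is_gaussian mu Sigma Q -> measurable_fun setT h -> (forall x, 0 <= h x) ->
  (sqrt2pi ^+ k)%:E * \int[Q]_x h x =
  \int[lambda k]_z (h (mu +
    sqrtmx Sigma *m (z : 'cV[R]_k))%R * (gauss_cV z)%:E).
Proof.
move=> [Spd QE] mh h0.
have [Ss Sunit SS SiS] := sqrtmx_posdef Spd.
set S := sqrtmx Sigma in Ss Sunit SS SiS *.
pose e (x : borelcV R k) : R := expR (- bform (invmx Sigma) x x / 2).
pose K : R := (Num.sqrt ((2 * pi) ^+ k * \det Sigma))^-1%R.
have K0 : (0 <= K)%R by rewrite invr_ge0 sqrtr_ge0.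
have e0 x : (0 <= e x)%R by exact: expR_ge0.
have me : measurable_fun setT e.
  by apply: measurable_expR_half; exact: measurable_bform.
have pE x : gaussian_pdf mu Sigma x = (K * e (x - mu))%R by [].
have mshift (a : 'cV[R]_k) :
    measurable_fun setT (fun x : borelcV R k =>
      (x : 'cV[R]_k) + a : borelcV R k)%R.
  exact: measurable_cV_add.
have mp : measurable_fun setT (gaussian_pdf mu Sigma : borelcV R k -> R).
  rewrite (_ : gaussian_pdf mu Sigma = fun x => K * e (x - mu))%R.
    by apply: measurable_funM => //; exact: (measurableT_comp me).
  by apply/funext => x; rewrite pE.
have p0 (x : borelcV R k) : (0 <= gaussian_pdf mu Sigma x)%R.
  by rewrite pE mulr_ge0.
have Qint f : measurable_fun setT f -> (forall x, 0 <= f x) ->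
    \int[Q]_x f x =
      K%:E * \int[lambda k]_x (f ((x : 'cV[R]_k) + mu)%R * (e x)%:E).
  move=> mf f0.
  rewrite (@integral_density _ _ _ (lambda k) _ (gaussian_pdf mu Sigma))//;
    last first.
    move=> E mE; apply: etrans (QE E mE) _; apply: lebesgue_intE => [|x].
      by apply/measurable_EFinP/measurable_funM => //; exact: measurable_indic.
    by rewrite lee_fin mulr_ge0.
  rewrite -[LHS](integral_lebesgue_cV_shift mu); last 2 first.
  - by apply: emeasurable_funM => //; exact/measurable_EFinP.
  - by move=> x; rewrite mule_ge0// lee_fin.
  rewrite -ge0_integralZl_EFin//; last 2 first.
  - by move=> x _; rewrite mule_ge0// lee_fin.
  - apply: emeasurable_funM; first exact: (measurableT_comp mf).
    exact/measurable_EFinP.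
  by apply: eq_integral => x _; rewrite pE addrK EFinM muleCA.
have Ke : K%:E * \int[lambda k]_x (e x)%:E = 1.
  have := Qint (cst 1) (measurable_cst _) (fun=> lee01).
  rewrite integral_cst// mul1e; move=> QK; apply/esym.
  apply: etrans (esym (@probability_setT _ _ _ Q)) _; rewrite QK.
  by congr (_ * _); apply: eq_integral => x _; rewrite mul1e.
have eS z : e (S *m (z : 'cV[R]_k)) = gauss_cV z.
  by rewrite /e bform_mul Ss SiS bform1.
pose f (x : borelcV R k) := h ((x : 'cV[R]_k) + mu)%R * (e x)%:E.
have mf : measurable_fun setT f.
  apply: emeasurable_funM; first exact: (measurableT_comp mh).
  exact/measurable_EFinP.
have f0 x : 0 <= f x by rewrite mule_ge0// lee_fin.
have eN (x : 'cV[R]_k) : (e (- x)%R)%:E = (e x)%:E by rewrite /e bformNN.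
have me' : measurable_fun setT (fun x : borelcV R k => (e x)%:E).
  exact/measurable_EFinP.
have e0' x : 0 <= (e x)%:E by rewrite lee_fin.
(* With the unnormalized density [e] as the even test function of the linear
   change of variables, the constant factor is known from [Ke]. *)
have lin : \int[lambda k]_x f (S *m (x : 'cV[R]_k)) *
      \int[lambda k]_x (e x)%:E =
    \int[lambda k]_x f x * (sqrt2pi ^+ k)%:E.
  apply: etrans (integral_lebesgue_cV_linear Sunit mf f0 me' e0' eN) _.
  by congr (_ * _); rewrite -integral_gauss_cV; under eq_integral do rewrite eS.
transitivity (\int[lambda k]_x f (S *m (x : 'cV[R]_k))); last first.
  by apply: eq_integral => x _; rewrite /f addrC eS.
rewrite -[RHS]mule1 -Ke [RHS]muleCA lin Qint// [LHS]muleCA; congr (_ * _).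
exact: muleC.
Qed.

Lemma measurable_bform_gt k (M : 'M[R]_k) (a : 'cV[R]_k) (t : R) :
  measurable ([set z : 'cV[R]_k | (t < bform M a z)%R] : set (borelcV R k)).
Proof.
rewrite -[X in measurable X]setTI.
apply: (@measurable_fun_ltr _ _ _ setT (cst t)
  (fun z : borelcV R k => bform M a z)) => //.
exact: measurable_bform.
Qed.

Lemma Qfun_integral (c : R) : (sqrt2pi * Qfun c)%:E =
  \int[@lebesgue_measure R]_(x in `]c, +oo[) (expR (- x ^+ 2 / 2))%:E.
Proof.
have mg : measurable_fun setT (fun x : R => (expR (- x ^+ 2 / 2))%:E).
  by apply/measurable_EFinP; exact: measurable_gauss_R.
rewrite /Qfun mulVKf ?gt_eqF ?sqrt2pi_gt0//.
rewrite integral_itv_obnd_cbnd; last exact: measurable_funS mg.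
rewrite fineK// ge0_fin_numE; last by apply: integral_ge0 => x _;
  rewrite lee_fin expR_ge0.
apply: le_lt_trans (ltry sqrt2pi); rewrite -integral_gauss_R.
apply: ge0_subset_integral => // x _; rewrite lee_fin; exact: expR_ge0.
Qed.

(** By rotation invariance [a] may be replaced by [r] times the first basis vector. The half-space
    then constrains the first coordinate alone, and the other [k] coordinates contribute
    [sqrt2pi ^+ k]. *)
Lemma bform_gaussian_tail k (a : 'cV[R]_k) (t : R) : (0 < sqnorm a)%R ->
  \int[lambda k]_z (gauss_cV z *
     \1_[set z : 'cV[R]_k | (t < bform 1%:M a z)%R] z)%:E =
  (sqrt2pi ^+ k * Qfun (t / Num.sqrt (sqnorm a)))%:E.
Proof.
case: k a => [|k] a; first by rewrite sqnormE big_ord0 ltxx.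
move=> a0; pose r := Num.sqrt (sqnorm a).
have r0 : (0 < r)%R by rewrite sqrtr_gt0.
pose e : 'cV[R]_k.+1 := col_mx (r%:M : 'cV_1) (0 : 'cV_k)%R.
have ea : sqnorm e = sqnorm a.
  by rewrite sqnorm_col_mx sqnorm0 addr0 sqr_sqrtr// sqnorm_ge0.
have [H [Hs HH He]] := householder ea.
pose f (z : borelcV R k.+1) := (gauss_cV z *
  \1_[set z : 'cV[R]_k.+1 | (t < bform 1%:M a z)%R] z)%:E.
have mf : measurable_fun setT f.
  apply/measurable_EFinP/measurable_funM; first exact: measurable_gauss_cV.
  by apply: measurable_indic; exact: measurable_bform_gt.
have f0 x : 0 <= f x by rewrite lee_fin mulr_ge0// gauss_cV_ge0.
have Hu : H \in unitmx by have /mulmx1_unit[] := HH.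
have gH z : gauss_cV (H *m z) = gauss_cV z.
  by rewrite /gauss_cV -!bform1 bform_mul Hs mulmx1 HH.
have aH z : bform 1%:M a (H *m z) = bform 1%:M e z.
  by rewrite -He /bform trmx_mul Hs !mulmx1 mulmxA -(mulmxA _ H H) HH mulmx1.
have fH z : f (H *m z) = (gauss_cV z *
    \1_[set z : 'cV[R]_k.+1 | (t < bform 1%:M e z)%R] z)%:E.
  rewrite /f gH !indicE; congr (_ * (nat_of_bool _)%:R)%:E.
  by apply/idP/idP; rewrite !inE/= aH.
have be (x : R) (y : 'cV[R]_k) :
    bform 1%:M e (col_mx (x%:M : 'cV_1) y : 'cV[R]_k.+1) = (r * x)%R.
  by apply: etrans (bform1_col_mx r x 0%R y) _;
    rewrite /bform trmx0 !mul0mx mxE addr0.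
have mg : measurable_fun setT (fun x : borelcV R k.+1 => (gauss_cV x)%:E).
  by apply/measurable_EFinP; exact: measurable_gauss_cV.
have g0 (x : borelcV R k.+1) : 0 <= (gauss_cV x)%:E by rewrite lee_fin
  gauss_cV_ge0.
have gN (x : 'cV[R]_k.+1) : (gauss_cV (- x)%R)%:E = (gauss_cV x)%:E.
  by rewrite /gauss_cV sqnormN.
have c0 : (sqrt2pi ^+ k.+1 != 0)%R by rewrite expf_neq0// gt_eqF// sqrt2pi_gt0.
(* [H] preserves [gauss_cV], so with [gauss_cV] as comparison function the known factors on both
   sides agree and cancel. *)
have -> : \int[lambda k.+1]_z f z =
  \int[lambda k.+1]_z f (H *m (z : 'cV[R]_k.+1)).
  have := integral_lebesgue_cV_linear Hu mf f0 mg g0 gN.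
  under [X in _ = _ * X -> _]eq_integral do rewrite gH.
  rewrite integral_gauss_cV => /(congr1 (fun x => x * (sqrt2pi ^+ k.+1)^-1%:E)).
  by rewrite -!muleA -EFinM divff// !mule1.
under eq_integral do rewrite fH.
rewrite integral_lebesgue_cVS; last 2 first.
- apply/measurable_EFinP/measurable_funM; first exact: measurable_gauss_cV.
  by apply: measurable_indic; exact: measurable_bform_gt.
- by move=> x; rewrite lee_fin mulr_ge0// gauss_cV_ge0.
transitivity (\int[@lebesgue_measure R]_x ((expR (- x ^+ 2 / 2) *
    \1_(`]t / r, +oo[%classic : set R) x)%:E * (sqrt2pi ^+ k)%:E)).
  apply: eq_integral => x _.
  rewrite -integral_gauss_cV -ge0_integralZl_EFin//.
  - apply: eq_integral => y _; rewrite gauss_cVS -EFinM mulrAC;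
      congr (_ * _ * _)%:E.
    rewrite !indicE; congr ((nat_of_bool _)%:R).
    by apply/idP/idP; rewrite !inE/= be in_itv/= andbT ltr_pdivrMr// mulrC.
  - by move=> y _; rewrite lee_fin gauss_cV_ge0.
  - by apply/measurable_EFinP; exact: measurable_gauss_cV.
rewrite ge0_integralZr//.
- rewrite exprSr -mulrA EFinM muleC Qfun_integral; congr (_ * _).
  rewrite [RHS]integral_mkcond; apply: eq_integral => x _.
  by rewrite patchE indicE; case: ifPn => _; rewrite ?mulr1 ?mulr0.
- apply/measurable_EFinP/measurable_funM; first exact: measurable_gauss_R.
  exact: measurable_indic.
- by rewrite lee_fin exprn_ge0// ltW// sqrt2pi_gt0.
Qed.
End gaussian_measure.
(** * The chi-square law *)

Section radial_integrals.
Context {R : realType}.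
Local Open Scope ereal_scope.
Local Notation mu := (@lebesgue_measure R).
Local Notation lambda := (@lebesgue_cV R).

Lemma density_measure d (X : measurableType d) (m : {measure set X -> \bar R})
    (p : X -> R) : measurable_fun setT p -> (forall x, 0 <= p x)%R ->
  exists nu : {measure set X -> \bar R},
    forall E, measurable E -> nu E = \int[m]_x (p x * \1_E x)%:E.
Proof.
move=> mp p0; pose nu (E : set X) := \int[m]_(x in E) (p x)%:E.
have nu0 : nu set0 = 0 by rewrite /nu integral_set0.
have nu_ge0 E : 0 <= nu E by apply: integral_ge0 => x _; rewrite lee_fin.
have nu_sa : semi_sigma_additive nu.
  move=> F mF tF mUF; rewrite /nu ge0_integral_bigcup//.
  - by apply: is_cvg_ereal_nneg_natsum_cond => n _ _; exact: nu_ge0.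
  - by apply: measurable_funTS; exact/measurable_EFinP.
  - by move=> x _; rewrite lee_fin.
pose M := isMeasure.Build _ _ _ nu nu0 nu_ge0 nu_sa.
pose nu' : {measure set X -> \bar R} := HB.pack nu M.
exists nu' => E mE; rewrite /= /nu integral_mkcond; apply: eq_integral => x _.
by rewrite patchE indicE; case: ifPn => _; rewrite ?mulr1 ?mulr0.
Qed.

(** For [a < 1], as with [a = 1/2] in dimension 1, the integrand is unbounded at 0. The fundamental
    theorem of calculus is applied on intervals away from 0, which then increase to the whole. *)
Lemma integral_powR (a b : R) : (0 < a)%R -> (0 < b)%R ->
  \int[mu]_(x in `]0%R, b[) (a * x `^ (a - 1))%:E = (b `^ a)%:E.
Proof.
move=> a0 b0.
pose f x : R := (a * x `^ (a - 1))%R.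
(* The offset [n.+2] makes [l n < b] strict from [n = 0] on. *)
pose l n : R := (b * n.+2%:R^-1)%R.
have l0 n : (0 < l n)%R by rewrite mulr_gt0// invr_gt0.
have lb n : (l n < b)%R.
  by rewrite /l -[ltRHS]mulr1 ltr_pM2l// invf_lt1// ltr1n.
have mf : measurable_fun setT (fun x => (f x)%:E).
  apply/measurable_EFinP/measurable_funM => //; exact: measurable_powR.
have f0 x : 0 <= (f x)%:E by rewrite lee_fin mulr_ge0 ?powR_ge0// ltW.
have FTC n : \int[mu]_(x in `[l n, b]) (f x)%:E = (b `^ a)%:E - (l n `^ a)%:E.
  have pos x : x \in `[l n, b] -> (0 < x)%R.
    by rewrite in_itv/= => /andP[+ _]; exact: lt_le_trans.
  have cts (c x : R) : (0 < x)%R -> {for x, continuous (@powR R ^~ c)}.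
    move=> x0; apply: differentiable_continuous; apply/derivable1_diffP.
    by apply: derivable_powR; rewrite in_itv/= x0.
  apply: (@continuous_FTC2 _ f (@powR R ^~ a)) => //.
  - apply: continuous_in_subspaceT => x /set_mem/= xi.
    by apply: cvgM; [exact: cvg_cst|exact: cts (pos _ xi)].
  - split.
    + move=> x /subset_itv_oo_cc/pos x0; apply: derivable_powR.
      by rewrite in_itv/= x0.
    + by apply: cvg_at_right_filter; exact: cts.
    + by apply: cvg_at_left_filter; exact: cts.
  - move=> x /subset_itv_oo_cc/pos x0.
    by rewrite powR_derive1// in_itv/= x0.
have l_cvg0 : l n @[n --> \oo] --> 0%R.
  rewrite -(mulr0 b); apply: cvgM; first exact: cvg_cst.
  by have := @cvg_harmonic R; rewrite -cvg_shiftS.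
have lcvg : (fun n => (b `^ a)%:E - (l n `^ a)%:E) @ \oo --> (b `^ a)%:E.
  rewrite -[X in _ --> X]sube0; apply: cvgeB => //; first exact: cvg_cst.
  apply/fine_cvgP; split; first exact: nearW.
  by have /cvg_at_rightP := powR_cvg0 a0; exact.
have UF : `]0%R, b]%classic = \bigcup_n `[l n, b]%classic.
  apply/seteqP; split => [x|x [n _]] /=; rewrite !in_itv/=; last first.
    by move=> /andP[lx ->]; rewrite (lt_le_trans (l0 n)).
  move=> /andP[x0 xb].
  have [N _ NP] := l_cvg0 _ (nbhs_lt x0).
  have lx : (l N < x)%R by apply: (NP N) => //=; exact: ltW.
  by exists N => //=; rewrite in_itv/= xb ltW.
rewrite integral_itv_bndo_bndc; last exact: measurable_funS mf.
have ndF : nondecreasing_seq (fun n => `[l n, b]%classic).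
  move=> i j ij; apply/subsetPset; apply: subset_itvr; rewrite bnd_simp.
  by rewrite ler_pM2l// lef_pV2 ?posrE// ler_nat.
have c1 : \int[mu]_(x in `[l n, b]) (f x)%:E @[n --> \oo] -->
    \int[mu]_(x in \bigcup_n `[l n, b]%classic) (f x)%:E.
  by apply: ge0_nondecreasing_set_cvg_integral => // n; exact: measurable_funTS.
have c2 : (fun n => \int[mu]_(x in `[l n, b]) (f x)%:E) @ \oo --> (b `^ a)%:E.
  by under eq_cvg do rewrite FTC.
by rewrite UF; exact: (cvg_unique _ c1 c2).
Qed.

(** The measures to be compared may have infinite total mass; open rays are stable under
    intersection, generate the Borel sets and exhaust the line, so finiteness on them suffices. *)
Lemma measure_unique_ray (m1 m2 : {measure set (measurableTypeR R) -> \bar R}) :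
  (forall b : R, m1 `]-oo, b[%classic = m2 `]-oo, b[%classic) ->
  (forall b : R, m1 `]-oo, b[%classic < +oo) ->
  forall A, measurable A -> m1 A = m2 A.
Proof.
move=> m12 fin.
refine (@measure_unique _ R (measurableTypeR R) (@RGenInftyO.G R)
  (fun n => `]-oo, (n%:R : R)%R[%classic) _ _ _ _ m1 m2 _ _).
- exact: RGenInftyO.measurableE.
- move=> _ _ [x ->] [y ->]; exists (Num.min x y).
  by apply/seteqP; split => z /=; rewrite !in_itv/= lt_min => /andP.
- by move=> n; exists n%:R.
- rewrite -subTset => x _; exists (Num.truncn `|x|).+1 => //=; rewrite in_itv/=.
  by apply: le_lt_trans (ler_norm x) _; exact: truncnS_gt.
- by move=> _ [x ->].
- by move=> n.
Qed.

Lemma measurable_sqnorm_lt k (s : R) :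
  measurable ([set z : 'cV[R]_k | (sqnorm z < s)%R] : set (borelcV R k)).
Proof.
rewrite -[X in measurable X]setTI.
apply: (@measurable_fun_ltr _ _ _ setT (fun z : borelcV R k => sqnorm z)
  (cst s)) => //.
exact: measurable_sqnorm.
Qed.

Lemma sqnorm_ball k (s : R) : (0 < s)%R ->
  lambda k [set z : 'cV[R]_k | (sqnorm z < s)%R] =
  (s `^ (k%:R / 2))%:E * lambda k [set z : 'cV[R]_k | (sqnorm z < 1)%R].
Proof.
move=> s0; have ms t := @measurable_sqnorm_lt k t.
have sE t : lambda k [set z : 'cV[R]_k | (sqnorm z < t)%R] =
    \int[lambda k]_z (\1_[set z : 'cV[R]_k | (sqnorm z < t)%R] z)%:E.
  by rewrite integral_indic// setIT.
rewrite !sE -(@integral_lebesgue_cV_scale _ _ (Num.sqrt s)) ?sqrtr_gt0//.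
- congr (_%:E * _).
    by rewrite mulrC powRrM powR12_sqrt ?ltW// powR_mulrn ?sqrtr_ge0.
  apply: eq_integral => z _; rewrite !indicE; congr ((nat_of_bool _)%:R%:E).
  suff sz : (sqnorm (Num.sqrt s *: (z : 'cV[R]_k)) < s)%R = (sqnorm z < 1)%R.
    by apply/idP/idP; rewrite !inE/= sz.
  by rewrite sqnormZ sqr_sqrtr ?ltW// mulrC -ltr_pdivlMr// divff ?gt_eqF.
- by apply/measurable_EFinP; exact: measurable_indic.
Qed.

Lemma sqnorm_ball1_fin k :
  lambda k [set z : 'cV[R]_k | (sqnorm z < 1)%R] \is a fin_num.
Proof.
rewrite ge0_fin_numE//.
have m1 := @measurable_sqnorm_lt k 1.
rewrite -[X in X < _](_ : \int[lambda k]_z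
    (\1_[set z : 'cV[R]_k | (sqnorm z < 1)%R] z)%:E = _); last first.
  by rewrite integral_indic// setIT.
(* On the unit ball [exp(1/2) * gauss_cV z] is at least 1, and its integral is known. *)
apply: (@le_lt_trans _ _ (\int[lambda k]_z ((expR (1 / 2))%:E * (gauss_cV
  z)%:E))).
  apply: ge0_le_integral => //.
  - by apply/measurable_EFinP; exact: measurable_indic.
  - apply/measurable_EFinP/measurable_funM => //; exact: measurable_gauss_cV.
  move=> z _; rewrite -EFinM lee_fin -expRD indicE; case: (boolP (z \in _)).
    by rewrite inE/= => z1; rewrite -[leLHS]expR0 ler_expR; lra.
  by rewrite expR_ge0.
rewrite ge0_integralZl_EFin ?expR_ge0//.
- by rewrite integral_gauss_cV -EFinM ltry.
- by move=> z _; rewrite lee_fin gauss_cV_ge0.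
- by apply/measurable_EFinP; exact: measurable_gauss_cV.
Qed.

(* By homogeneity, the image of Lebesgue measure under [sqnorm] gives the ray
   below [b > 0] the mass [v * b `^ (k / 2)]. *)
Lemma integral_sqnorm k : (0 < k)%N ->
  exists2 C : R, (0 <= C)%R & forall h : R -> \bar R,
    measurable_fun setT h -> (forall x, 0 <= h x) ->
    \int[lambda k]_z h (sqnorm z) =
    C%:E * \int[mu]_(x in `]0%R, +oo[) (h x * (x `^ (k%:R / 2 - 1))%:E).
Proof.
move=> k0; set a : R := (k%:R / 2)%R.
have a0 : (0 < a)%R by rewrite divr_gt0// ltr0n.
pose v := fine (lambda k [set z : 'cV[R]_k | (sqnorm z < 1)%R]).
have vE : v%:E = lambda k [set z : 'cV[R]_k | (sqnorm z < 1)%R].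
  by rewrite /v fineK// sqnorm_ball1_fin.
have v0 : (0 <= v)%R by rewrite /v fine_ge0.
pose D : set R := `]0%R, +oo[%classic.
(* The derivative of the ray mass [v * x^a], cut off at 0 because rays ending at [b <= 0] have no
   mass. *)
pose p x : R := (v * (a * x `^ (a - 1)) * \1_D x)%R.
have mpow : measurable_fun setT (fun x : R => a * x `^ (a - 1))%R.
  by apply: measurable_funM => //; exact: measurable_powR.
have mp : measurable_fun setT p.
  apply: measurable_funM; first exact: measurable_funM.
  by apply: measurable_indic; exact: measurable_itv.
have p0 x : (0 <= p x)%R.
  by rewrite /p !mulr_ge0// ?powR_ge0// ltW.
have [m mE] := density_measure mu mp p0.
pose nrm : borelcV R k -> measurableTypeR R := fun z => sqnorm z.
have mnrm : measurable_fun setT nrm by exact: measurable_sqnorm.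
have nuE b : pushforward (lambda k) nrm `]-oo, b[%classic =
    (if (0 < b)%R then v * b `^ a else 0%R)%:E.
  rewrite /pushforward (_ : _ @^-1` _ =
    [set z : 'cV[R]_k | (sqnorm z < b)%R]); last first.
    by apply/seteqP; split => z /=; rewrite in_itv.
  case: ifPn => [b0|]; first by rewrite sqnorm_ball// -vE -EFinM mulrC.
  rewrite -leNgt => b0; rewrite (_ : [set _ | _] = set0) ?measure0//.
  apply/seteqP; split => // z /=; apply/negP; rewrite -leNgt.
  exact: le_trans b0 (sqnorm_ge0 _).
have mRay b : m `]-oo, b[%classic = (if (0 < b)%R then v * b `^ a else 0%R)%:E.
  rewrite mE//; case: ifPn => [b0|].
    rewrite EFinM -integral_powR// -ge0_integralZl_EFin//.
    - rewrite [RHS]integral_mkcond; apply: eq_integral => x _.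
      rewrite patchE /p !indicE !mem_setE !in_itv/= andbT.
      by case: ltP => x0; case: ltP => xb; rewrite ?mulr1 ?mulr0 ?mul0r.
    - by move=> x _; rewrite lee_fin mulr_ge0 ?powR_ge0// ltW.
    - by apply: measurable_funTS; exact/measurable_EFinP.
  rewrite -leNgt => b0; rewrite integral0_eq// => x _.
  rewrite /p !indicE !mem_setE !in_itv/= andbT.
  case: ltP => x0; rewrite ?mulr0 ?mul0r//.
  by case: ltP => xb; rewrite ?mulr0//; have := lt_trans x0 xb;
    rewrite ltNge b0.
unshelve epose (nu := (pushforward (lambda k) nrm : {measure set
  (measurableTypeR R) -> \bar R})).
  exact: mnrm.
have nu_m A : measurable A -> nu A = m A.
  apply: measure_unique_ray => b; first by rewrite mRay -nuE.
  by rewrite [X in X < _]nuE ltry.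
exists (v * a)%R; first by rewrite mulr_ge0// ltW.
move=> h mh h0.
rewrite (@ge0_integral_comp _ _ _ _ _ _ nrm)//.
rewrite (@integral_density _ _ _ mu nu p)//; last first.
  by move=> E mEE; apply: etrans (nu_m _ mEE) _; exact: mE.
rewrite -ge0_integralZl_EFin//.
- rewrite [RHS]integral_mkcond; apply: eq_integral => x _.
  rewrite patchE /p indicE; case: ifPn => _; last by rewrite mulr0 mule0.
  by rewrite mulr1 mulrA EFinM muleCA.
- by move=> x _; rewrite mule_ge0// lee_fin powR_ge0.
- apply: emeasurable_funM; apply: measurable_funTS => //.
  by apply/measurable_EFinP; exact: measurable_powR.
- by rewrite mulr_ge0// ltW.
Qed.

(* The constant of [integral_sqnorm] is obtained from the total Gaussian
   mass. *)
Lemma gauss_ball k (s : R) : (0 < k)%N ->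
  \int[lambda k]_z
    (\1_[set z : 'cV[R]_k | (sqnorm z <= s)%R] z * gauss_cV z)%:E =
  (sqrt2pi ^+ k * chi2_cdf k s)%:E.
Proof.
move=> k0; have [C C0 CE] := integral_sqnorm k0.
set a : R := (k%:R / 2)%R in CE *.
have a0 : (0 < a)%R by rewrite divr_gt0// ltr0n.
have mexp : measurable_fun setT (fun x : R => expR (- x / 2)).
  exact: measurable_expR_half.
have mpow : measurable_fun setT (fun x : R => x `^ (a - 1))%R.
  exact: measurable_powR.
pose f (x : R) : R := (x `^ (a - 1) * expR (- x / 2))%R.
have f0 x : (0 <= f x)%R by rewrite mulr_ge0 ?powR_ge0 ?expR_ge0.
have mf : measurable_fun setT f by exact: measurable_funM.
have mEf : measurable_fun setT (fun x => (f x)%:E) by exact/measurable_EFinP.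
have Ef0 x : 0 <= (f x)%:E by rewrite lee_fin.
pose J := \int[mu]_(x in `]0%R, +oo[) (f x)%:E.
(* As this product is positive and finite, [C > 0] and [J] is finite; both are read off below. *)
have CJ : C%:E * J = (sqrt2pi ^+ k)%:E.
  rewrite -integral_gauss_cV (CE (fun x => (expR (- x / 2))%:E))//.
  - by congr (_ * _); apply: eq_integral => x _; rewrite /f mulrC EFinM.
  - exact/measurable_EFinP.
have J0 : 0 <= J by apply: integral_ge0 => x _; exact: Ef0.
have c0 : (0 < sqrt2pi ^+ k :> R)%R by rewrite exprn_gt0// sqrt2pi_gt0.
have C_gt0 : (0 < C)%R.
  rewrite lt_neqAle C0 andbT; apply/eqP => C00; move: CJ.
  by rewrite -C00 mul0e => /eqP; rewrite eqe lt_eqF.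
have Jfin : J \is a fin_num.
  rewrite ge0_fin_numE// ltey; apply/eqP => Joo; move: CJ.
  by rewrite Joo gt0_muley// lte_fin.
pose G := \int[mu]_(t in `[0%R, +oo[) (t `^ (a - 1) * expR (- t))%:E.
have mg : measurable_fun setT (fun t : R => (t `^ (a - 1) * expR (- t))%:E).
  apply/measurable_EFinP/measurable_funM => //.
  by apply: measurableT_comp => //; exact: measurableT_comp.
have g0 (t : R) : 0 <= (t `^ (a - 1) * expR (- t))%:E.
  by rewrite lee_fin mulr_ge0 ?powR_ge0 ?expR_ge0.
(* The substitution [x = 2 t] identifies [J] with [2^a] times the Gamma integral, which is the
   normalizing constant inside [chi2_cdf]. *)
have JG : J = (2 `^ a)%:E * G.
  rewrite /J /G -integral_itv_obnd_cbnd; last exact: measurable_funS mg.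
  rewrite [in LHS]integral_mkcond -(@integral_lebesgue_affine _ 2 0)//.
  - rewrite -mulr_powRB1// EFinM -muleA; congr (_ * _).
    rewrite -ge0_integralZl_EFin ?powR_ge0//; last exact: measurable_funS mg.
    rewrite [RHS]integral_mkcond; apply: eq_integral => t _.
    rewrite !patchE !mem_setE !in_itv/= !andbT addr0 pmulr_rgt0//.
    case: ltP => // t0; rewrite /f powRM ?ltW// -EFinM -mulrA;
      congr (_ * (_ * expR _))%:E.
    by field.
  - by apply/(measurable_restrictT _ _).1 => //; exact: measurable_funTS.
  - by move=> x; rewrite patchE; case: ifPn.
have K0 : (0 < 2 `^ a :> R)%R by rewrite powR_gt0.
have Gfin : G \is a fin_num.
  rewrite ge0_fin_numE ?ltey; last by apply: integral_ge0.
  apply/eqP => Goo; move: Jfin; rewrite JG Goo gt0_muley ?lte_fin//.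
have JE : fine J = (2 `^ a * Gamma a)%R by rewrite JG fineM.
pose I := \int[mu]_(x in `[0%R, s]) (f x)%:E.
have I0 : 0 <= I by apply: integral_ge0.
have IJ : I <= J.
  rewrite /I /J integral_itv_obnd_cbnd; last exact: measurable_funS mEf.
  by apply: ge0_subset_integral => //;
    [exact: measurable_funS mEf|exact: subset_itvl].
have Ifin : I \is a fin_num.
  by rewrite ge0_fin_numE// (le_lt_trans IJ)// -ge0_fin_numE.
have -> : chi2_cdf k s = ((fine J)^-1 * fine I)%R.
  rewrite /chi2_cdf -/a -JE /Rintegral.
  have -> : \int[mu]_(x in `[0%R, s])
      ((fine J)^-1 * x `^ (a - 1) * expR (- x / 2))%:E = (fine J)^-1%:E * I.
    rewrite /I -ge0_integralZl_EFin//; last 2 first.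
    - exact: measurable_funS mEf.
    - by rewrite invr_ge0 fine_ge0.
    by apply: eq_integral => x _; rewrite -EFinM mulrA.
  by rewrite fineM.
have Jpos : (fine J != 0)%R.
  apply/eqP => J00; move: CJ; rewrite -(fineK Jfin) J00 mule0.
  by move/eqP; rewrite eqe lt_eqF.
have -> : (sqrt2pi ^+ k = C * fine J)%R.
  by apply: EFin_inj; rewrite -CJ EFinM fineK.
rewrite mulrA mulfK// EFinM fineK//.
pose h (x : R) : \bar R :=
  (\1_(`]-oo, s]%classic : set R) x * expR (- x / 2))%:E.
have mh : measurable_fun setT h.
  apply/measurable_EFinP/measurable_funM; last exact: mexp.
  by apply: measurable_indic; exact: measurable_itv.
have h0 x : 0 <= h x by rewrite lee_fin mulr_ge0 ?expR_ge0.
transitivity (\int[lambda k]_z h (sqnorm z)).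
  apply: eq_integral => z _; rewrite /h /gauss_cV !indicE.
  by congr ((nat_of_bool _)%:R * _)%:E; apply/idP/idP; rewrite !inE/= in_itv.
rewrite (CE _ mh h0); congr (_ * _).
rewrite /I -integral_itv_obnd_cbnd; last exact: measurable_funS mEf.
rewrite [LHS]integral_mkcond [RHS]integral_mkcond; apply: eq_integral => x _.
rewrite !patchE !mem_setE !in_itv/= andbT /h indicE mem_setE in_itv/= -EFinM.
case: ltP => x0 //=; case: leP => xs; last by rewrite !mul0r.
by rewrite mul1r mulrC.
Qed.

End radial_integrals.

(** * The Gaussian tail function and its inverse *)

Section Qfun_inverse.
Context {R : realType}.
Local Open Scope ereal_scope.
Local Notation mu := (@lebesgue_measure R).
Local Notation N01 := (@normal_prob R 0 1).

Lemma normal_pdf01 (x : R) : normal_pdf 0 1 x =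
  (sqrt2pi^-1 * expR (- x ^+ 2 / 2))%R.
Proof.
rewrite normal_pdfE ?oner_neq0// /normal_peak /normal_fun subr0 expr1n mul1r.
by rewrite /sqrt2pi mulr_natl.
Qed.

Lemma Qfun_normal (c : R) : (Qfun c)%:E = N01 `]c, +oo[%classic.
Proof.
rewrite /normal_prob; under eq_integral do rewrite normal_pdf01 EFinM.
rewrite ge0_integralZl_EFin//; last 2 first.
- by apply: measurable_funTS; apply/measurable_EFinP; exact: measurable_gauss_R.
- by rewrite invr_ge0 ltW// sqrt2pi_gt0.
by rewrite -Qfun_integral -EFinM mulKf// gt_eqF// sqrt2pi_gt0.
Qed.

Lemma Qfun_nonincreasing (a b : R) : (a <= b)%R -> (Qfun b <= Qfun a)%R.
Proof.
move=> ab; rewrite -lee_fin !Qfun_normal le_measure ?inE//.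
by apply: subset_itvr; rewrite bnd_simp.
Qed.

(** The standard normal density is at most its peak [sqrt2pi^-1]. This yields the continuity used
    for inverting [Qfun]. *)
Lemma Qfun_lipschitz (a b : R) : (a <= b)%R ->
  (Qfun a - Qfun b <= sqrt2pi^-1 * (b - a))%R.
Proof.
move=> ab; rewrite lerBlDl -lee_fin EFinD !Qfun_normal.
have -> : `]a, +oo[%classic = `]a, b] `|` `]b, +oo[ :> set R.
  by rewrite -itv_bndbnd_setU.
rewrite measureU//; last first.
  apply/seteqP; split => // x /=; rewrite !in_itv/= andbT => -[/andP[_]].
  by move=> /le_lt_trans/[apply]; rewrite ltxx.
rewrite [leLHS]addeC; apply: leeD2l => //; rewrite /= /normal_prob.
have -> : (sqrt2pi^-1 * (b - a))%:E =
  \int[mu]_(x in `]a, b]) (cst (sqrt2pi^-1)%:E x).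
  by rewrite integral_cst//= lebesgue_measure_itv/= lte_fin;
    case: ltgtP ab => // -> _; rewrite subrr mulr0 mule0.
apply: ge0_le_integral => //.
- by move=> x _; rewrite lee_fin normal_pdf_ge0.
- by apply: measurable_funTS; apply/measurable_EFinP;
    exact: measurable_normal_pdf.
- move=> x _; rewrite lee_fin normal_pdf01 ler_piMr ?invr_ge0 ?(ltW
    sqrt2pi_gt0)//.
  by rewrite -[leRHS]expR0 ler_expR mulNr oppr_le0 mulr_ge0 ?sqr_ge0.
Qed.

Lemma Qfun_continuous : continuous (@Qfun R).
Proof.
move=> x; apply/cvgrPdist_le => e e0; near=> y.
have lip : (`|Qfun x - Qfun y| <= sqrt2pi^-1 * `|x - y|)%R.
  have [xy|yx] := leP x y.
    rewrite [X in (_ <= _ * X)%R]distrC.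
    by rewrite !ger0_norm ?subr_ge0 ?Qfun_nonincreasing// Qfun_lipschitz.
  have {}yx := ltW yx; rewrite [X in (X <= _)%R]distrC.
  by rewrite !ger0_norm ?subr_ge0 ?Qfun_nonincreasing// Qfun_lipschitz.
apply: le_trans lip _; rewrite mulrC ler_pdivrMr ?sqrt2pi_gt0//.
near: y; apply: cvgr_dist_le; first exact: cvg_id.
by rewrite mulr_gt0// sqrt2pi_gt0.
Unshelve. all: by end_near. Qed.

(** Intermediate value theorem. The limits 1 and 0 at the two infinities hold because [Qfun] is the
    complementary distribution function of the identity under the standard normal law. *)
Lemma QinvK (p : R) : (0 < p)%R -> (p < 1)%R -> Qfun (Qinv p) = p.
Proof.
move=> p0 p1; rewrite /Qinv.
suff : [set c : R | Qfun c = p] !=set0 by case/getPex.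
pose id_mfun := isMeasurableFun.Build _ _ _ _ (idfun : measurableTypeR R -> R)
  (@measurable_id _ _ setT).
pose X : {RV N01 >-> R} := HB.pack (idfun : measurableTypeR R -> R) id_mfun.
have QX : ccdf X = EFin \o @Qfun R.
  by apply/funext => c; rewrite /= Qfun_normal.
have cvgN : @Qfun R @ -oo%R --> (1 : R)%R.
  by have /fine_cvg := cvg_ccdfNy1 X; rewrite QX.
have cvgP : @Qfun R @ +oo%R --> (0 : R)%R.
  by have /fine_cvg := cvg_ccdfy0 X; rewrite QX.
have [a pa] : exists a : R, (p < Qfun a)%R.
  by apply: filter_ex (cvgr_gt _ cvgN _ p1).
have [b bp] : exists b : R, (Qfun b < p)%R.
  by apply: filter_ex (cvgr_lt _ cvgP _ p0).
have ab : (a <= b)%R.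
  rewrite leNgt; apply/negP => /ltW/Qfun_nonincreasing.
  by rewrite leNgt (lt_trans bp pa).
have [||c _ cp] := @IVT _ (@Qfun R) a b p ab.
- by apply: continuous_subspaceT; exact: Qfun_continuous.
- by rewrite ge_min le_max (ltW bp) (ltW pa) orbT.
- by exists c.
Qed.

End Qfun_inverse.
(** * Differential privacy *)

Section gaussian_mechanism.
Context {R : realType}.
Local Open Scope ereal_scope.
Local Notation lambda := (@lebesgue_cV R).

Lemma Rfun_gt0 (eps delta : R) : (0 < eps)%R -> (0 < Rfun eps delta)%R.
Proof.
move=> e0; rewrite /Rfun divr_gt0 ?mulr_gt0//.
set q := Qinv delta.
have s0 : (0 <= Num.sqrt (q ^+ 2 + 2 * eps))%R by exact: sqrtr_ge0.
have : (q ^+ 2 < Num.sqrt (q ^+ 2 + 2 * eps) ^+ 2)%R.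
  by rewrite sqr_sqrtr ?addr_ge0 ?sqr_ge0 ?mulr_ge0 ?(ltW e0)// ltrDl mulr_gt0.
by nra.
Qed.

(** With [s = sqrt(q^2 + 2 eps)], one has [2 eps = (s - q) * (s + q)], so
    [1 / Rfun eps delta = s - q], and the hypothesis reads [r <= s - q]. *)
Lemma Rfun_spec (eps delta r : R) : (0 < eps)%R -> (0 < r)%R ->
  (Rfun eps delta * r <= 1)%R -> (Qinv delta <= (eps - r ^+ 2 / 2) / r)%R.
Proof.
move=> e0 r0; have := @Rfun_gt0 eps delta e0.
rewrite /Rfun; set q := Qinv delta; set s := Num.sqrt _.
rewrite pmulr_lgt0 ?invr_gt0 ?mulr_gt0// => qs0.
rewrite mulrAC ler_pdivrMr ?mulr_gt0// mul1r ler_pdivlMr// => qsr.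
have s0 : (0 <= s)%R by exact: sqrtr_ge0.
have s2 : (s ^+ 2 = q ^+ 2 + 2 * eps)%R.
  by rewrite sqr_sqrtr ?addr_ge0 ?sqr_ge0 ?mulr_ge0 ?(ltW e0).
have rs : (r <= s - q)%R.
  by rewrite -(ler_pM2l qs0); move: qsr s2; rewrite !expr2; lra.
(* If [r + q >= 0], square [r + q <= s]; otherwise [q < - r] and [r^2 / 2 + q * r] is negative. *)
have [rq|rq] := leP 0%R (r + q)%R; nra.
Qed.

(** The log-likelihood ratio of two unit Gaussians is affine in the sample point, so the set where
    the loss exceeds [eps] is a half-space and [bform_gaussian_tail] gives its mass. *)
Lemma gauss_cV_ratio k (x y : 'cV[R]_k) (eps : R) :
  (expR eps * gauss_cV (x + y) < gauss_cV x)%R =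
  (eps - sqnorm y / 2 < bform 1%:M y x)%R.
Proof.
rewrite /gauss_cV -expRD ltr_expR -!bform1 bformDl !bformDr.
rewrite (@bformC _ _ _ x y) ?trmx1//.
by apply/idP/idP; lra.
Qed.

Lemma gaussian_mechanism k (mu : 'cV[R]_k) (Sigma : 'M[R]_k)
    (Q : probability (borelcV R k) R) (a a' : 'cV[R]_k) (eps delta : R)
    (S : set (borelcV R k)) :
  is_gaussian mu Sigma Q -> (0 < eps)%R -> (0 < delta)%R -> (delta < 1)%R ->
  (Rfun eps delta ^+ 2 * bform (invmx Sigma) (a - a')%R (a - a')%R <= 1)%R ->
  measurable S ->
  Q [set w | S (a + (w : 'cV[R]_k))%R] <=
    (expR eps)%:E * Q [set w | S (a' + (w : 'cV[R]_k))%R] + delta%:E.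
Proof.
move=> Qg e0 d0 d1 Rd mS; have [Spd _] := Qg.
have [Ts Tu TT TiT] := sqrtmx_posdef Spd.
set T := sqrtmx Sigma in Ts Tu TT TiT.
have mSa (b : 'cV[R]_k) : measurable ([set w | S (b +
  (w : 'cV[R]_k))%R] : set (borelcV R k)).
  rewrite -[X in measurable X]setTI.
  by apply: (measurable_cV_add (f := cst (b : borelcV R k)) (g := id)) => //.
pose g (b z : 'cV[R]_k) : R := gauss_cV (z - b)%R.
pose I (z : borelcV R k) : R := \1_S (mu + T *m (z : 'cV[R]_k))%R.
have c0 : (0 < sqrt2pi ^+ k :> R)%R by rewrite exprn_gt0// sqrt2pi_gt0.
have mI : measurable_fun setT I.
  apply: (measurableT_comp (f := \1_S : borelcV R k -> R)) => //.
  by apply: measurable_cV_add => //; exact: measurable_cV_mul.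
have mg b : measurable_fun setT (g b : borelcV R k -> R).
  apply: (measurableT_comp (measurable_gauss_cV (R := R) (k := k))).
  exact: measurable_cV_add.
(* Moves [b] from the event into the Gaussian weight: both probabilities become integrals of the
   same indicator [I] against shifted weights. *)
have QE b : (sqrt2pi ^+ k)%:E * Q [set w | S (T *m b + (w : 'cV[R]_k))%R] =
    \int[lambda k]_z (I z * g b z)%:E.
  have QI : Q [set w | S (T *m b + (w : 'cV[R]_k))%R] =
      \int[Q]_w (\1_S (T *m b + (w : 'cV[R]_k))%R)%:E.
    by rewrite -[X in Q X]setIT -integral_indic.
  rewrite QI (is_gaussian_integral Qg); last 2 first.
  - apply/measurable_EFinP;
      apply: (measurableT_comp (f := \1_S : borelcV R k -> R)) => //.
    exact: measurable_cV_add.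
  - by move=> w; rewrite lee_fin.
  rewrite -(integral_lebesgue_cV_shift (- b)%R).
  - apply: eq_integral => z _; rewrite -EFinM /I /g; congr (\1_S _ * _)%:E.
    by rewrite addrCA -mulmxDr addrCA subrr addr0.
  - apply: emeasurable_funM; apply/measurable_EFinP;
      last exact: measurable_gauss_cV.
    apply: (measurableT_comp (f := \1_S : borelcV R k -> R)) => //.
    apply: (measurable_cV_add (f := cst (T *m b : borelcV R k))) => //.
    by apply: measurable_cV_add => //; exact: measurable_cV_mul.
  - by move=> z; rewrite mule_ge0// lee_fin gauss_cV_ge0.
pose b := invmx T *m a; pose b' := invmx T *m a'; pose D := (b - b')%R.
have TD : T *m D = (a - a')%R by rewrite mulmxBr !mulKVmx.
have nD : bform (invmx Sigma) (a - a')%R (a - a')%R = sqnorm D.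
  by rewrite -TD bform_mul Ts TiT bform1.
rewrite -(mulKVmx Tu a) -(mulKVmx Tu a') -/b -/b'.
(* Equal inputs are treated apart, since the tail bound divides by the length of [D]. *)
have [D0|D0] := eqVneq D 0%R.
  have -> : b = b' by apply/eqP; rewrite -subr_eq0; exact/eqP.
  apply: (@le_trans _ _ ((expR eps)%:E * Q [set w | S (T *m b' +
    (w : 'cV[R]_k))%R])).
    by rewrite lee_pemull// lee_fin -[leLHS]expR0 ler_expR ltW.
  by rewrite leeDl// lee_fin ltW.
rewrite -sqnorm_gt0 in D0.
pose r := Num.sqrt (sqnorm D).
have r0 : (0 < r)%R by rewrite sqrtr_gt0.
have r2 : (r ^+ 2 = sqnorm D)%R by rewrite sqr_sqrtr// ltW.
have Qd : (Qfun ((eps - sqnorm D / 2) / r) <= delta)%R.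
  rewrite -[leRHS](QinvK d0 d1); apply: Qfun_nonincreasing.
  rewrite -r2; apply: Rfun_spec => //.
  have Rr0 : (0 < Rfun eps delta * r)%R by rewrite mulr_gt0// Rfun_gt0.
  by rewrite -(@expr_le1 _ 2) ?(ltW Rr0)// exprMn r2 -nD.
(* [B] is the event that the privacy loss exceeds [eps]. *)
pose B := [set z : 'cV[R]_k | (eps - sqnorm D / 2 < bform 1%:M D z)%R].
have mB : measurable (B : set (borelcV R k)) by exact: measurable_bform_gt.
rewrite -(@lee_pmul2l _ (sqrt2pi ^+ k)%:E)//.
rewrite ge0_muleDr; [|by rewrite mule_ge0// lee_fin expR_ge0|by rewrite lee_fin
  ltW].
rewrite muleCA !QE.
have mIg x : measurable_fun setT (fun z : borelcV R k => (I z * g x z)%:E).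
  by apply/measurable_EFinP; exact: measurable_funM.
have Ig0 x z : 0 <= (I z * g x z)%:E by rewrite lee_fin mulr_ge0// gauss_cV_ge0.
have mBg : measurable_fun setT (fun z : borelcV R k =>
  (gauss_cV z * \1_B z)%:E).
  apply/measurable_EFinP/measurable_funM; first exact: measurable_gauss_cV.
  exact: measurable_indic.
have Bg0 z : 0 <= (gauss_cV z * \1_B z)%:E by rewrite lee_fin mulr_ge0//
  gauss_cV_ge0.
have mBgs : measurable_fun setT
    (fun z : borelcV R k => (gauss_cV (z - b)%R * \1_B (z - b)%R)%:E).
  apply: (measurableT_comp (g := fun z : borelcV R k =>
    ((z : 'cV[R]_k) - b : borelcV R k)%R) mBg).
  exact: measurable_cV_add.
have meI : measurable_fun setT
    (fun z : borelcV R k => (expR eps)%:E * (I z * g b' z)%:E).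
  exact: measurable_funeM.
have eI0 z : 0 <= (expR eps)%:E * (I z * g b' z)%:E.
  by rewrite mule_ge0// lee_fin expR_ge0.
(* Pointwise bound: off the shifted event [B] the ratio of weights is at most [expR eps], and on it
   the second summand alone dominates. *)
apply: (@le_trans _ _ (\int[lambda k]_z ((expR eps)%:E * (I z * g b' z)%:E +
    (gauss_cV (z - b)%R * \1_B (z - b)%R)%:E))).
  apply: ge0_le_integral => //; first exact: emeasurable_funD.
  move=> z _; rewrite -EFinM -EFinD lee_fin /I /g !indicE.
  case: (boolP (_ \in S)) => _; last first.
    by rewrite !mul0r mulr0 add0r mulr_ge0// gauss_cV_ge0.
  rewrite !mul1r; case: (boolP (_ \in B)) => [_|].
    by rewrite mulr1 lerDr mulr_ge0 ?expR_ge0// gauss_cV_ge0.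
  rewrite notin_setE /B/= -gauss_cV_ratio mulr0 addr0 => /negP; rewrite -leNgt.
  by rewrite /D addrA subrK.
rewrite ge0_integralD//.
rewrite ge0_integralZl_EFin ?expR_ge0//.
apply: leeD => //.
rewrite (integral_lebesgue_cV_shift (- b)%R mBg)//.
by rewrite bform_gaussian_tail// -EFinM lee_fin ler_pM2l.
Qed.

End gaussian_mechanism.

(** * The difference of two independent draws from the prior *)

Section gaussian_prior.
Context {R : realType}.
Local Open Scope ereal_scope.
Local Notation lambda := (@lebesgue_cV R).

(** Completing the square in [z]. For fixed [x] the last factor is a translate of a fixed function,
    so integrating out [z] gives a constant and leaves the weight of the difference [x]. *)
Lemma gauss_cV_polarize k (x z : 'cV[R]_k) :
  (gauss_cV (x + z) * gauss_cV z =
   expR (- sqnorm x / 2 / 2) * expR (- sqnorm (z + 2^-1 *: x)))%R.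
Proof.
rewrite /gauss_cV -!expRD; congr expR; rewrite -!bform1.
rewrite !(bformDl, bformDr, bformZl, bformZr) (@bformC _ _ _ z x) ?trmx1//.
by field.
Qed.

Lemma integral_expR_sqnorm k :
  (Num.sqrt 2 ^+ k)%:E * \int[lambda k]_z (expR (- sqnorm z))%:E =
    (sqrt2pi ^+ k)%:E.
Proof.
rewrite -integral_gauss_cV -[RHS](@integral_lebesgue_cV_scale _ _ (Num.sqrt 2))
  ?sqrtr_gt0//.
- congr (_ * _); apply: eq_integral => z _;
    rewrite /gauss_cV sqnormZ sqr_sqrtr//.
  by congr (expR _)%:E; field.
- by apply/measurable_EFinP; exact: measurable_gauss_cV.
- by move=> x; rewrite lee_fin gauss_cV_ge0.
Qed.

Lemma gauss_difference_ball k (r : R) : (0 < k)%N ->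
  \int[lambda k]_z \int[lambda k]_z'
    (\1_[set x : 'cV[R]_k | (sqnorm x <= r)%R] ((z' : 'cV[R]_k) - z)%R *
     gauss_cV z' * gauss_cV z)%:E =
  (sqrt2pi ^+ k * sqrt2pi ^+ k * chi2_cdf k (r / 2))%:E.
Proof.
move=> k0; pose B s := [set x : 'cV[R]_k | (sqnorm x <= s)%R].
have mB s : measurable (B s : set (borelcV R k)).
  rewrite -[X in measurable X]setTI.
  apply: (@measurable_fun_ler _ _ _ setT (fun z : borelcV R k => sqnorm z)
    (cst s)) => //.
  exact: measurable_sqnorm.
have m1B s : measurable_fun setT (\1_(B s) : borelcV R k -> R).
  exact: measurable_indic.
have mg := measurable_gauss_cV (R := R) (k := k).
pose f (x z : 'cV[R]_k) : \bar R := (\1_(B r) x * expR (- sqnorm x / 2 / 2) *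
  expR (- sqnorm (z + 2^-1 *: x)))%:E.
have mh : measurable_fun setT (fun x : borelcV R k =>
    (\1_(B r) x * expR (- sqnorm x / 2 / 2))%R).
  apply: measurable_funM => //; apply: measurableT_comp => //.
  apply: measurable_funM => //; apply: measurable_funM => //.
  by apply: measurableT_comp => //; exact: measurable_sqnorm.
have mE : measurable_fun setT (fun x : borelcV R k => expR (- sqnorm x)).
  by do 2 apply: measurableT_comp => //; exact: measurable_sqnorm.
transitivity (\int[lambda k]_z \int[lambda k]_x f x z).
  apply: eq_integral => z _;
    rewrite -(integral_lebesgue_cV_shift (z : 'cV[R]_k)).
  - apply: eq_integral => x _; rewrite addrK -mulrA gauss_cV_polarize.
    by rewrite /f mulrA.
  - apply/measurable_EFinP; apply: measurable_funM => //;
      apply: measurable_funM => //.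
    apply: (measurableT_comp (f := \1_(B r) : borelcV R k -> R)) => //.
    exact: measurable_cV_add.
  - by move=> x; rewrite lee_fin !mulr_ge0 ?gauss_cV_ge0.
have f0 x z : 0 <= f x z by rewrite lee_fin !mulr_ge0 ?expR_ge0.
rewrite tonelli//; last first.
  apply/measurable_EFinP; apply: measurable_funM.
    by apply: (measurableT_comp mh); exact: measurable_snd.
  apply: (measurableT_comp (f :=
    fun x : borelcV R k => expR (- sqnorm x))) => //.
  apply: measurable_cV_add; first exact: measurable_fst.
  by apply: measurable_cV_scale; exact: measurable_snd.
pose G := \int[lambda k]_z (expR (- sqnorm z))%:E.
have G0 : 0 <= G by apply: integral_ge0 => z _; rewrite lee_fin expR_ge0.
transitivity (\int[lambda k]_x ((\1_(B r) x * expR (- sqnorm x / 2 / 2))%:E *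
  G)).
  apply: eq_integral => x _.
  have -> : G = \int[lambda k]_z
      (expR (- sqnorm ((z : 'cV[R]_k) + 2^-1 *: (x : 'cV[R]_k))))%:E.
    apply/esym; apply: (integral_lebesgue_cV_shift (2^-1 *: (x : 'cV[R]_k))%R
      (f := fun z : borelcV R k => (expR (- sqnorm z))%:E)).
      exact/measurable_EFinP.
    by move=> z; rewrite lee_fin expR_ge0.
  rewrite -ge0_integralZl_EFin ?mulr_ge0 ?expR_ge0//.
  apply/measurable_EFinP.
  apply: (measurableT_comp (f :=
    fun x : borelcV R k => expR (- sqnorm x))) => //.
  exact: measurable_cV_add.
have mEh : measurable_fun setT (fun x : borelcV R k =>
    (\1_(B r) x * expR (- sqnorm x / 2 / 2))%:E).
  exact/measurable_EFinP.
have Eh0 (x : borelcV R k) : 0 <= (\1_(B r) x * expR (- sqnorm x / 2 / 2))%:E.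
  by rewrite lee_fin mulr_ge0 ?expR_ge0.
rewrite ge0_integralZr//.
have s20 : (0 < Num.sqrt 2 :> R)%R by rewrite sqrtr_gt0.
(* Rescaling by [sqrt 2] turns [exp(- sqnorm x / 4)] into [gauss_cV] and the bound [r] into [r / 2];
   the Jacobian is absorbed with [G] by [integral_expR_sqnorm]. *)
rewrite -(integral_lebesgue_cV_scale s20 mEh Eh0).
have -> : \int[lambda k]_x (\1_(B r) (Num.sqrt 2 *: (x : 'cV[R]_k)) *
     expR (- sqnorm (Num.sqrt 2 *: (x : 'cV[R]_k)) / 2 / 2))%:E =
    (sqrt2pi ^+ k * chi2_cdf k (r / 2))%:E.
  rewrite -gauss_ball//; apply: eq_integral => x _.
  rewrite /B !indicE /gauss_cV sqnormZ sqr_sqrtr//.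
  congr ((nat_of_bool _)%:R * expR _)%:E; last by field.
  by apply/idP/idP; rewrite !inE/= sqnormZ sqr_sqrtr// ler_pdivlMr// mulrC.
rewrite muleAC integral_expR_sqnorm -EFinM; congr EFin; ring.
Qed.

Lemma measurable_bform_diff k (M : 'M[R]_k) (r : R) :
  measurable [set p : borelcV R k * borelcV R k |
    (bform M ((p.1 : 'cV[R]_k) - p.2) ((p.1 : 'cV[R]_k) - p.2) <= r)%R].
Proof.
rewrite -[X in measurable X]setTI.
have md : measurable_fun setT (fun p : borelcV R k * borelcV R k =>
    ((p.1 : 'cV[R]_k) - (p.2 : 'cV[R]_k) : borelcV R k)%R).
  apply: measurable_cV_add; first exact: measurable_fst.
  by apply: measurable_cV_opp; exact: measurable_snd.
apply: (@measurable_fun_ler _ _ _ setT (fun p : borelcV R k * borelcV R k =>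
  bform M ((p.1 : 'cV[R]_k) - p.2)%R ((p.1 : 'cV[R]_k) - p.2)%R) (cst r)) => //.
exact: measurable_bform.
Qed.

Lemma gaussian_prior_ball k (Sigma : 'M[R]_k) (Q : probability (borelcV R k) R)
    (r : R) : (0 < k)%N -> is_gaussian 0%R Sigma Q ->
  (Q \x Q) [set p : borelcV R k * borelcV R k |
    (bform (invmx Sigma) ((p.1 : 'cV[R]_k) - p.2)
       ((p.1 : 'cV[R]_k) - p.2) <= r)%R] =
  (chi2_cdf k (r / 2))%:E.
Proof.
move=> k0 Qg; have [Spd _] := Qg.
have [Ss Su SS SiS] := sqrtmx_posdef Spd.
set S := sqrtmx Sigma in Ss Su SS SiS.
set X := [set p | _].
have mX : measurable X by exact: measurable_bform_diff.
have c0 : (sqrt2pi ^+ k != 0 :> R)%R by rewrite expf_neq0// gt_eqF//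
  sqrt2pi_gt0.
have cge0 : (0 <= sqrt2pi ^+ k :> R)%R by rewrite exprn_ge0// ltW// sqrt2pi_gt0.
have secE u : (sqrt2pi ^+ k)%:E * Q (xsection X u) =
    \int[lambda k]_z' (\1_X (u, S *m (z' : 'cV[R]_k))%R * gauss_cV z')%:E.
  have -> : Q (xsection X u) = \int[Q]_w (\1_(xsection X u) w)%:E.
    by rewrite integral_indic ?setIT//; exact: measurable_xsection.
  rewrite (is_gaussian_integral Qg)//; last first.
    by apply/measurable_EFinP; apply: measurable_indic;
      exact: measurable_xsection.
  apply: eq_integral => z _; rewrite add0r -EFinM !indicE.
  by congr ((nat_of_bool _)%:R * _)%:E; apply/idP/idP;
    rewrite !inE /xsection/= inE.
have mQ : measurable_fun setT (fun u => Q (xsection X u)).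
  exact: measurable_fun_xsection.
suff main : (sqrt2pi ^+ k * sqrt2pi ^+ k)%:E * (Q \x Q) X =
    (sqrt2pi ^+ k * sqrt2pi ^+ k * chi2_cdf k (r / 2))%:E.
  move/(congr1 (fun x => (sqrt2pi ^+ k * sqrt2pi ^+ k)^-1%:E * x)) : main.
  by rewrite muleA -!EFinM mulVf ?mulf_neq0// mul1e mulKf// mulf_neq0.
rewrite -gauss_difference_ball// EFinM -muleA /product_measure1.
rewrite -ge0_integralZl_EFin//.
rewrite (is_gaussian_integral Qg)//.
apply: eq_integral => z _.
- rewrite /= add0r secE -ge0_integralZr//.
  + apply: eq_integral => z' _; rewrite -EFinM !indicE.
    congr ((nat_of_bool _)%:R * _ * _)%:E.
    rewrite /X; apply/idP/idP; rewrite !inE/=;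
    by rewrite -/S -mulmxBr bform_mul Ss SiS bform1 -opprB sqnormN.
  + apply/measurable_EFinP/measurable_funM; last exact: measurable_gauss_cV.
    apply: (measurableT_comp (f :=
      \1_X : borelcV R k * borelcV R k -> R)) => //.
    apply: measurable_fun_pair => //; exact: measurable_cV_mul.
  + by move=> z' _; rewrite lee_fin mulr_ge0// gauss_cV_ge0.
  + by rewrite lee_fin gauss_cV_ge0.
- exact: measurable_funeM.
- by move=> u; rewrite mule_ge0.
Qed.

End gaussian_prior.

(** * From the spectral condition to Bayesian privacy *)

Section bayesian_privacy.
Context {R : realType}.
Local Open Scope ereal_scope.

(** Taking the whole space as third event in [independent3] gives the product rule on rectangles,
    which determines the product measure. *)
Lemma distribution_pair d (Omega : measurableType d) (P : probability Omega R)
    d1 d2 (E1 : measurableType d1) (E2 : measurableType d2)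
    (U U' : {RV P >-> E1}) (W : {RV P >-> E2}) (Q : probability E1 R) X :
  (forall S, measurable S -> distribution P U S = Q S) ->
  (forall S, measurable S -> distribution P U' S = Q S) ->
  independent3 U U' W -> measurable X ->
  P [set omega | X (U omega, U' omega)] = (Q \x Q) X.
Proof.
move=> UQ U'Q indep mX.
have mUU : measurable_fun setT (fun omega => (U omega, U' omega)).
  exact: measurable_fun_pair.
unshelve epose (m := (pushforward P (fun omega => (U omega, U' omega)) :
  {measure set (E1 * E1)%type -> \bar R})).
  exact: mUU.
suff -> : (Q \x Q) X = m X by [].
apply: product_measure_unique => // A B mA mB.
have := indep A B setT mA mB measurableT.
rewrite preimage_setT setIT probability_setT mule1.
by move=> UU'; apply: etrans UU' _; congr (_ * _); [exact: UQ|exact: U'Q].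
Qed.

Lemma bform_lambda_max_le k l (N : 'M[R]_(l, k)) (Sigma : 'M[R]_k)
    (Sigma_w : 'M[R]_l) (c r : R) (u : 'cV[R]_k) :
  (0 < k)%N -> posdefmx Sigma -> posdefmx Sigma_w -> (0 < c)%R -> (0 < r)%R ->
  (c * r)%:E <= inv_sqrt_lambda_max
    (sqrtmx Sigma *m N^T *m invmx Sigma_w *m N *m sqrtmx Sigma) ->
  (bform (invmx Sigma) u u <= c ^+ 2)%R ->
  (r ^+ 2 * bform (invmx Sigma_w) (N *m u) (N *m u) <= 1)%R.
Proof.
move=> k0 Spd Wpd c0 r0; have [Ss Su SS SiS] := sqrtmx_posdef Spd.
set S := sqrtmx Sigma in Ss Su SS SiS *.
set O := S *m N^T *m invmx Sigma_w *m N *m S.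
have Ws : (invmx Sigma_w)^T = invmx Sigma_w by exact: trmx_invmx_sym Wpd.1.
have Os : O^T = O by rewrite /O !trmx_mul trmxK Ss Ws !mulmxA.
pose v := invmx S *m u; have uv : u = S *m v by rewrite mulKVmx.
have -> : bform (invmx Sigma) u u = sqnorm v.
  by rewrite uv bform_mul Ss SiS bform1.
have -> : bform (invmx Sigma_w) (N *m u) (N *m u) = bform O v v.
  by rewrite uv /bform /O !trmx_mul Ss !mulmxA.
have Ov := bform_le_lambda_max v k0 Os.
have v0 := sqnorm_ge0 v.
(* When [lambda_max] is 0 the hypothesis bounds nothing, but the form of [O] is then nonpositive. *)
rewrite /inv_sqrt_lambda_max; case: eqP => [L0 _ _|_].
  rewrite (le_trans _ ler01)// mulr_ge0_le0 ?sqr_ge0//.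
  by move: Ov; rewrite L0 mul0r.
rewrite lee_fin; set L := lambda_max O in Ov *; move=> crL vc.
(* For [L <= 0] both [Num.sqrt L] and its inverse are 0 by convention, against [0 < c * r]. *)
have [L0|L0] := leP L 0%R.
  by move: crL; rewrite ler0_sqrtr// invr0 leNgt mulr_gt0.
have s0 : (0 < Num.sqrt L)%R by rewrite sqrtr_gt0.
have : ((c * r) ^+ 2 * L <= 1)%R.
  rewrite -ler_pdivlMr// mul1r -[leRHS](sqr_sqrtr (ltW _)) ?invr_gt0//.
  by rewrite (sqrtrV (ltW L0)) ler_pXn2r// nnegrE ltW// ?mulr_gt0// invr_gt0.
rewrite exprMn => crL1.
have r20 : (0 < r ^+ 2)%R by rewrite exprn_gt0.
have Oc : (bform O v v <= c ^+ 2 * L)%R.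
  by apply: (le_trans Ov); rewrite mulrC ler_pM2r.
by move: (r ^+ 2)%R (c ^+ 2)%R r20 Oc crL1 => r2 c2; nra.
Qed.

Lemma gaussian_bayesian_dp k l (N : 'M[R]_(l, k)) (gamma eps delta : R)
    (Sigma : 'M[R]_k) (PU : probability (borelcV R k) R)
    (mu_w : 'cV[R]_l) (Sigma_w : 'M[R]_l) (PW : probability (borelcV R l) R)
    (c : R) :
  (gamma <= 1)%R -> (0 < eps)%R -> (0 < delta)%R -> (delta < 1)%R ->
  is_gaussian 0%R Sigma PU -> is_gaussian mu_w Sigma_w PW -> (0 < c)%R ->
  gamma = chi2_cdf k (c ^+ 2 / 2) ->
  (c * Rfun eps delta)%:E <= inv_sqrt_lambda_max
    (sqrtmx Sigma *m N^T *m invmx Sigma_w *m N *m sqrtmx Sigma) ->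
  bayesian_dp N PW PU gamma eps delta.
Proof.
move=> gamma1 e0 d0 d1 Ug Wg c0 gammaE cR d Omega P U U' W UE U'E WE indep S mS.
pose pr (u : 'cV[R]_k) := P [set omega | S (N *m u + (W omega : 'cV[R]_l))%R].
change (gamma%:E <= P [set omega |
  pr (U omega) <= (expR eps)%:E * pr (U' omega) + delta%:E]).
have mS_ (u : 'cV[R]_k) :
    measurable ([set w | S (N *m u + (w : 'cV[R]_l))%R] : set (borelcV R l)).
  rewrite -[X in measurable X]setTI.
  by apply: (measurable_cV_add (f := cst (N *m u : borelcV R l)) (g := id)).
have prE u : pr u = PW [set w | S (N *m u + (w : 'cV[R]_l))%R].
  by rewrite -WE.
(* For [k = 0] the chi-square law degenerates, but [U] and [U'] coincide. *)
have [k0|] := posnP k.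
  rewrite (_ : [set _ | _] = setT) ?probability_setT ?lee_fin//.
  apply/seteqP; split => // omega _ /=.
  have -> : U omega = U' omega by subst k; apply/matrixP => -[].
  apply: (@le_trans _ _ ((expR eps)%:E * pr (U' omega))).
    by rewrite lee_pemull// lee_fin -[leLHS]expR0 ler_expR ltW.
  by rewrite leeDl// lee_fin ltW.
move=> k0.
(* Makes the event in the definition of privacy measurable, so that its probability can be bounded
   below by that of the ellipsoidal event it contains. *)
have mpr : measurable_fun setT (pr : borelcV R k -> \bar R).
  rewrite (_ : pr = fun u =>
    \int[PW]_w (\1_S (N *m (u : 'cV[R]_k) + (w : 'cV[R]_l))%R)%:E).
    apply: measurable_integral => //; apply/measurable_EFinP.
    apply: (measurableT_comp (f := \1_S : borelcV R l -> R)) => //.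
    apply: measurable_cV_add; last exact: measurable_snd.
    by apply: measurable_cV_mul; exact: measurable_fst.
  by apply/funext => u; rewrite prE -[X in PW X]setIT -integral_indic.
rewrite gammaE -(gaussian_prior_ball _ k0 Ug).
set X := [set p | _].
have mX : measurable X by exact: measurable_bform_diff.
rewrite -(distribution_pair UE U'E indep mX).
apply: le_measure.
- rewrite inE -[X in measurable X]setTI.
  by apply: (measurable_fun_pair (f := U) (g := U')).
- rewrite inE -[X in measurable X]setTI; apply: measurable_lee => //.
    exact: (measurableT_comp mpr).
  apply: emeasurable_funD => //; apply: measurable_funeM.
  exact: (measurableT_comp mpr).
move=> omega; rewrite /X/= => Uc; rewrite !prE.
apply: gaussian_mechanism => //; first exact: Wg.
rewrite -mulmxBr; apply: bform_lambda_max_le cR Uc => //.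
- exact: Ug.1.
- exact: Wg.1.
- exact: Rfun_gt0.
Qed.

End bayesian_privacy.


Theorem theorem7 (R : realType) (n m q T : nat)
    (A : 'M[R]_n) (B : 'M[R]_(n, m)) (C : 'M[R]_(q, n)) (D : 'M[R]_(q, m))
    (gamma eps delta : R)
    (gamma_ge0 : 0 <= gamma) (gamma_le1 : gamma <= 1)
    (eps_gt0 : 0 < eps) (delta_gt0 : 0 < delta) (delta_lt : delta < 1 / 2)
    (Sigma : 'M[R]_(stackdim T m))
    (PU : probability (borelcV R (stackdim T m)) R)
    (PU_gaussian : is_gaussian 0 Sigma PU)
    (mu_w : 'cV[R]_(stackdim T q)) (Sigma_w : 'M[R]_(stackdim T q))
    (PW : probability (borelcV R (stackdim T q)) R)
    (PW_gaussian : is_gaussian mu_w Sigma_w PW)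
    (c : R) (c_gt0 : 0 < c)
    (c_def : gamma = chi2_cdf (T.+1 * m) (c ^+ 2 / 2)) :
  let N_T := io_matrix A B C D T in
  let O_T := sqrtmx Sigma *m N_T^T *m invmx Sigma_w *m N_T *m sqrtmx Sigma in
  ((c * Rfun eps delta)%:E <= inv_sqrt_lambda_max O_T)%E ->
  bayesian_dp N_T PW PU gamma eps delta.
Proof.
move=> N_T O_T cR.
(* The two dimensions agree only propositionally; the rewriting is confined to the degrees of
   freedom of [chi2_cdf], where no matrix type depends on them. *)
have stackE : stackdim T m = (T.+1 * m)%N by rewrite sum_nat_const card_ord.
apply: (gaussian_bayesian_dp gamma_le1 eps_gt0 delta_gt0 _ PU_gaussian
  PW_gaussian c_gt0 _ cR); last by rewrite stackE.
lra.
Qed.
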